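(* Let $k \geq 3$ be an integer and $0 < \delta \leq 1$. Let $c(k,\delta) > 0$ be any constant for which the following weighted Szemer\'edi theorem holds: for every $\eta > 0$ there is $N_0$ such that for all $N \geq N_0$ and every function $g \colon \mathbb{Z}_N \to [0,1]$ with $\mathbb{E}[g] \geq \delta$, \[ \mathbb{E}\bigl[ g(x)g(x+d)\cdots g(x+(k-1)d) \,\big\vert\, x,d \in \mathbb{Z}_N\bigr] \geq c(k,\delta) - \eta . \] Let $\mathcal{N}$ be an infinite set of positive integers, each relatively prime to $(k-1)!$, and for each $N \in \mathcal{N}$ let $\nu = \nu^{(N)} \colon \mathbb{Z}_N \to \mathbb{R}_{\geq 0}$ be such that the family $(\nu^{(N)})_{N\in\mathcal{N}}$ satisfies the $k$-linear forms condition. Then for every $\eta > 0$ there is $N_1$ (depending on $k$, $\delta$, $\eta$ and the rate of convergence in the $k$-linear forms condition for $\nu$) such that for every $N \in \mathcal{N}$ with $N \geq N_1$ and every function $f \colon \mathbb{Z}_N \to \mathbb{R}_{\geq 0}$ with $0 \leq f(x) \leq \nu^{(N)}(x)$ for all $x \in \mathbb{Z}_N$ and $\mathbb{E}[f] \geq \delta$, we have \[ \mathbb{E}\bigl[ f(x)f(x+d)f(x+2d)\cdots f(x+(k-1)d) \,\big\vert\, x,d \in \mathbb{Z}_N\bigr] \geq c(k,\delta) - \eta . \]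
   Context: $\mathbb{Z}_N = \mathbb{Z}/N\mathbb{Z}$. $\mathbb{E}[F(x_1,x_2,\dots)\vert P]$ denotes the average of $F$ over all choices of the variables uniformly among those satisfying $P$; $\mathbb{E}[f]$ means $\mathbb{E}[f(x)\vert x\in\mathbb{Z}_N]$. $k$-linear forms condition: a family of functions $\nu = \nu^{(N)} \colon \mathbb{Z}_N \to \mathbb{R}_{\geq 0}$ (indexed by $N$ in an infinite set) satisfies the $k$-linear forms condition if, for every choice of exponents $n_{j,\omega} \in \{0,1\}$ (for $j \in [k]=\{1,\dots,k\}$ and $\omega \in \{0,1\}^{[k]\setminus\{j\}}$), \[ \mathbb{E}\Bigl[\prod_{j=1}^k \prod_{\omega \in \{0,1\}^{[k]\setminus\{j\}}} \nu\Bigl(\sum_{i \in [k]\setminus\{j\}} (i-j)\, x_i^{(\omega_i)}\Bigr)^{n_{j,\omega}} \Big\vert\, x_1^{(0)},x_1^{(1)},\dots,x_k^{(0)},x_k^{(1)} \in \mathbb{Z}_N\Bigr] = 1 + o(1), \] where $o(1)$ denotes a quantity tending to $0$ as $N \to \infty$ (the rate of this convergence is what ''rate of convergence in the linear forms condition'' refers to). *)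

(* Defs.v *)
From mathcomp Require Import all_boot all_order all_algebra.
From mathcomp Require Import all_classical all_reals all_analysis.

Set Implicit Arguments.
Unset Strict Implicit.
Unset Printing Implicit Defensive.

Import Order.TTheory GRing.Theory Num.Theory.
Import numFieldNormedType.Exports.

Local Open Scope classical_set_scope.
Local Open Scope ring_scope.

(* The additive group Z/NZ, for N > 0. The library's 'Z_N is Z/2Z when N = 1,
   whereas 'I_N.-1.+1 has N elements for every N > 0 and carries addition
   modulo N; it is the trivial group at the junk value N = 0. *)
Notation Zmod N := 'I_(N.-1.+1).

Definition average (R : realType) (T : finType) (F : T -> R) : R :=
  (\sum_(x : T) F x) / #|T|%:R.

Definition ap_average (R : realType) (k N : nat) (f : Zmod N -> R) : R :=
  average (fun p : Zmod N * Zmod N => \prod_(i < k) f (p.1 + p.2 *+ i)).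

Definition weighted_szemeredi (R : realType) (k : nat) (delta c : R) : Prop :=
  forall eta : R, 0 < eta ->
  exists N0 : nat, forall N : nat, (0 < N)%N -> (N0 <= N)%N ->
  forall g : Zmod N -> R, (forall x, 0 <= g x <= 1) -> delta <= average g ->
  c - eta <= ap_average k g.

(* [k] is represented by 'I_k, i.e. shifted to {0, .., k-1}: only the
   differences i - j of indices occur below. *)
Definition others (k : nat) (j : 'I_k) := {i : 'I_k | i != j}.

Definition exponents (k : nat) : Type :=
  forall j : 'I_k, {ffun others j -> bool} -> bool.

(* x (i, b) is the variable x_i^(b). *)
Definition linear_forms_average (R : realType) (k N : nat)
    (nu : Zmod N -> R) (n : exponents k) : R :=
  average (fun x : {ffun 'I_k * bool -> Zmod N} =>
    \prod_(j < k) \prod_(w : {ffun others j -> bool})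
      nu (\sum_(i : others j)
            x (val i, w i) *~ ((val i)%:Z - j%:Z)) ^+ n j w).

(* The k-linear forms condition with its o(1) made explicit: eps is the rate of
   convergence. There are finitely many choices of exponents, so a single rate
   for all of them is no restriction: a family satisfies the condition exactly
   when it does so for some eps. *)
Definition linear_forms_condition (R : realType) (k : nat) (NN : set nat)
    (nu : forall N : nat, Zmod N -> R) (eps : nat -> R) : Prop :=
  eps @ \oo --> (0 : R) /\
  forall N : nat, NN N -> forall n : exponents k,
    `|linear_forms_average (nu N) n - 1| <= eps N.

(* Main.v *)
(* Following Conlon, Fox and Zhao.  With L_j(x) = sum_i (i - j) x_i, the point
   (L_1(x), .., L_k(x)) is a uniformly distributed k-term progression, and
   L_j(x) does not depend on x_j, so the count of progressions is the count
   E prod_j f(L_j(x)) of a weighted simplex in a k-partite hypergraph.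

   Transference has two halves.  A dense model theorem replaces f <= nu by some
   g with values in [0, 1] that is close to f in the cut norm, i.e. against all
   products of bounded functions each of which ignores one coordinate.  Here g
   comes from online projected gradient ascent: a test that distinguishes f from
   the current model is added to it and the result is clipped to [0, 1].  If
   this went on for too long, the average of the tests would have a positive
   part that nu distinguishes from 1, which polynomial approximation excludes.

   A relative counting lemma shows that closeness in cut norm preserves the
   count.  One unbounded edge function f_j at a time is traded for a bounded
   one: replacing the other factors by their average over x_j (densification)
   gives a function that is majorized by one with mean 1 and small variance,
   and the Cauchy-Schwarz inequality reduces the error to linear forms in nu. *)

Require Import Defs.
From mathcomp Require Import all_boot all_order all_algebra.
From mathcomp Require Import all_classical all_reals all_analysis.
From mathcomp Require Import perm ring lra.

Set Implicit Arguments.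
Unset Strict Implicit.
Unset Printing Implicit Defensive.

Import Order.TTheory GRing.Theory Num.Theory.
Import numFieldNormedType.Exports.

Local Open Scope classical_set_scope.
Local Open Scope ring_scope.

(** * Averages *)

Section Average.
Variable R : realType.

Section OneType.
Variable T : finType.
Implicit Types F H : T -> R.

Lemma eq_average F H : F =1 H -> average F = average H.
Proof. by move=> FH; congr (_ / _); apply: eq_bigr => x _. Qed.

Lemma averageD F H : average (fun x => F x + H x) = average F + average H.
Proof. by rewrite /average big_split mulrDl. Qed.

Lemma averageZ a F : average (fun x => a * F x) = a * average F.
Proof. by rewrite /average -mulr_sumr mulrA. Qed.

Lemma averageN F : average (fun x => - F x) = - average F.
Proof. by rewrite /average sumrN mulNr. Qed.

Lemma averageB F H : average (fun x => F x - H x) = average F - average H.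
Proof. by rewrite averageD averageN. Qed.

Lemma average_sum (I : Type) (r : seq I) (F : I -> T -> R) :
  average (fun x => \sum_(i <- r) F i x) = \sum_(i <- r) average (F i).
Proof. by rewrite /average exchange_big /= mulr_suml. Qed.

Lemma ler_average F H : (forall x, F x <= H x) -> average F <= average H.
Proof. by move=> FH; rewrite ler_wpM2r ?invr_ge0 // ler_sum. Qed.

Lemma average_ge0 F : (forall x, 0 <= F x) -> 0 <= average F.
Proof. by move=> F0; rewrite divr_ge0 ?sumr_ge0. Qed.

Lemma ler_norm_average F : `|average F| <= average (fun x => `|F x|).
Proof. by rewrite normrM normfV normr_nat ler_wpM2r ?invr_ge0 ?ler_norm_sum. Qed.

Lemma average_cst (a : R) : T -> average (fun _ : T => a) = a.
Proof.
move=> x0; rewrite /average sumr_const -(mulr_natr a) mulfK // pnatr_eq0.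
by rewrite -lt0n; apply/card_gt0P; exists x0.
Qed.

Lemma reindex_average (h : T -> T) F : injective h ->
  average F = average (F \o h).
Proof. by move=> hI; rewrite /average (reindex_inj hI). Qed.

(** The average of [B * (v * H - u) ^+ 2] is a nonnegative quadratic form in [u] and [v]; for
    [b > 0] its value at [u = e], [v = b] gives the inequality. *)
Lemma average_CauchySchwarz (B H : T -> R) : (forall x, 0 <= B x) ->
  average (fun x => B x * H x) ^+ 2 <=
  average B * average (fun x => B x * H x ^+ 2).
Proof.
move=> B0; set b := average B; set d := average (fun x => _ * _ ^+ 2).
set e := average _; have b0 : 0 <= b by apply: average_ge0.
have quad u v : 0 <= v ^+ 2 * d - u * v * e *+ 2 + u ^+ 2 * b.
  have <- : average (fun x => B x * (v * H x - u) ^+ 2) =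
      v ^+ 2 * d - u * v * e *+ 2 + u ^+ 2 * b.
    have -> : - (u * v * e *+ 2) = - (u * v *+ 2) * e by rewrite mulNr mulrnAl.
    rewrite /d /e /b -!averageZ -!averageD.
    by apply: eq_average => x; ring.
  by apply: average_ge0 => x; rewrite mulr_ge0 ?sqr_ge0.
have [b_gt0|b_le0] := ltP 0 b; last first.
  have b_eq0 : b = 0 by apply/eqP; rewrite eq_le b_le0.
  (* For [b = 0] the form at [u = d + 1], [v = e] equals [- (d + 2) * e ^+ 2], which forces
     [e = 0]. *)
  rewrite b_eq0 mul0r; have := quad (d + 1) e.
  have d0 : 0 <= d by apply: average_ge0 => x; rewrite mulr_ge0 ?sqr_ge0.
  by rewrite b_eq0; have := sqr_ge0 e; nra.
have := quad e b.
have -> : b ^+ 2 * d - e * b * e *+ 2 + e ^+ 2 * b = b * (b * d - e ^+ 2) by ring.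
by rewrite pmulr_rge0 // subr_ge0.
Qed.

End OneType.

Lemma average_bij (S T : finType) (h : S -> T) (F : T -> R) : bijective h ->
  average F = average (F \o h).
Proof.
move=> hB; rewrite /average (bij_eq_card hB); congr (_ / _).
by rewrite (reindex h) //; apply: onW_bij.
Qed.

Lemma average_pair (S T : finType) (F : S * T -> R) :
  average F = average (fun x => average (fun y => F (x, y))).
Proof.
rewrite /average card_prod natrM invfM mulrA mulrAC; congr (_ / _).
by rewrite -mulr_suml pair_bigA /=; congr (_ / _); apply: eq_bigr => -[].
Qed.

Lemma exchange_average (S T : finType) (F : S -> T -> R) :
  average (fun x => average (F x)) = average (fun y => average (F^~ y)).
Proof.
rewrite -(average_pair (fun p => F p.1 p.2)).
rewrite -(average_pair (fun p => F p.2 p.1)).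
have -> : average (fun p : T * S => F p.2 p.1) =
  average ((fun p : S * T => F p.1 p.2) \o (fun p : T * S => (p.2, p.1))) by [].
by rewrite -average_bij //; exists (fun p => (p.2, p.1)) => -[].
Qed.

End Average.

(** * Functions on a product space, one coordinate at a time *)

Section Update.
Variables (R : realType) (J : finType) (G : finType).
Implicit Types (x y : {ffun J -> G}) (a b : J) (s t : G).

Definition upd y a t : {ffun J -> G} := [ffun i => if i == a then t else y i].

Lemma upd_same y a t : upd y a t a = t.
Proof. by rewrite ffunE eqxx. Qed.

Lemma upd_other y a t b : b != a -> upd y a t b = y b.
Proof. by rewrite ffunE => /negbTE ->. Qed.

Lemma upd_upd y a s t : upd (upd y a s) a t = upd y a t.
Proof. by apply/ffunP => i; rewrite !ffunE; case: eqP. Qed.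

Lemma upd_id y a : upd y a (y a) = y.
Proof. by apply/ffunP => i; rewrite ffunE; case: eqP => [->|]. Qed.

Definition indep (S : Type) a (F : {ffun J -> G} -> S) :=
  forall y t, F (upd y a t) = F y.

Lemma indep_prod (I : Type) (r : seq I) (P : pred I) a
    (F : I -> {ffun J -> G} -> R) : (forall i, P i -> indep a (F i)) ->
  indep a (fun y => \prod_(i <- r | P i) F i y).
Proof. by move=> Fa y t; apply: eq_bigr => i Pi; apply: Fa. Qed.

Lemma indepM a (F H : {ffun J -> G} -> R) :
  indep a F -> indep a H -> indep a (fun y => F y * H y).
Proof. by move=> Fa Ha y t; rewrite Fa Ha. Qed.

(* The involution (y, t) |-> (upd y a t, y a) exchanges y a and t. *)
Lemma average_upd a (F : {ffun J -> G} -> R) : G ->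
  average F = average (fun y => average (fun t => F (upd y a t))).
Proof.
move=> t0; rewrite -(average_pair (fun p => F (upd p.1 a p.2))).
pose h (p : {ffun J -> G} * G) := (upd p.1 a p.2, p.1 a).
have hI : injective h.
  by apply: (can_inj (g := h)) => -[y t]; rewrite /h /= upd_same upd_upd upd_id.
have -> : average (fun p => F (upd p.1 a p.2)) = average ((fun p => F p.1) \o h).
  exact: eq_average.
rewrite -reindex_average // average_pair /=; apply: eq_average => y.
by rewrite average_cst.
Qed.

Lemma average_updM a (P F : {ffun J -> G} -> R) : G -> indep a P ->
  average (fun y => P y * F y) =
  average (fun y => P y * average (fun t => F (upd y a t))).
Proof.
move=> t0 Pa; rewrite (average_upd a) //; apply: eq_average => y.
by rewrite -averageZ; apply: eq_average => t; rewrite Pa.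
Qed.

Definition swap a b y : {ffun J -> G} :=
  [ffun i => if i == a then y b else if i == b then y a else y i].

(* Replace the factor P by its bound B, which depends on neither coordinate,
   and double the coordinate a into the pair a, b. *)
Lemma doubling_CauchySchwarz a b (P B H : {ffun J -> G} -> R) :
  G -> a != b -> indep a P -> indep a B -> indep b B -> indep b H ->
  (forall y, `|P y| <= B y) ->
  average (fun y => P y * H y) ^+ 2 <=
  average B * average (fun y => B y * (H y * H (swap a b y))).
Proof.
move=> t0 ab Pa Ba Bb Hb PB.
have B0 y : 0 <= B y by apply: le_trans (PB y).
pose h y := average (fun t => H (upd y a t)).
have h_upd y t : h (upd y a t) = h y.
  by rewrite /h; apply: eq_average => s; rewrite upd_upd.
(* As [H] ignores [b], resampling the coordinates [a] and [b] makes the two factors [H] independent,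
   and their average is the square of [h]. *)
have -> : average (fun y => B y * (H y * H (swap a b y))) =
    average (fun y => B y * h y ^+ 2).
  rewrite (average_updM (a := b)) // (average_updM (a := a)) //.
  apply: eq_average => y; congr (_ * _).
  rewrite expr2 {1}/h mulrC -averageZ; apply: eq_average => s.
  rewrite mulrC -averageZ; apply: eq_average => t.
  rewrite Hb; congr (_ * _).
  have -> : swap a b (upd (upd y a s) b t) = upd (upd y a t) b s.
    apply/ffunP => i; rewrite !ffunE (negbTE ab) !eqxx.
    case: (eqVneq i b) => [->|ib]; first by rewrite eq_sym (negbTE ab).
    by case: eqP.
  by rewrite Hb.
have -> : average (fun y => P y * H y) = average (fun y => P y * h y).
  exact: average_updM.
have -> : average (fun y => B y * h y ^+ 2) = average (fun y => B y * `|h y| ^+ 2).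
  by apply: eq_average => y; rewrite real_normK ?num_real.
apply: le_trans (average_CauchySchwarz (fun y => `|h y|) B0).
rewrite -[leLHS]real_normK ?num_real // ler_sqr ?nnegrE ?normr_ge0 //; last first.
  by apply: average_ge0 => y; rewrite mulr_ge0.
apply: le_trans (ler_norm_average _) _; apply: ler_average => y.
by rewrite normrM ler_wpM2r.
Qed.

End Update.

(** * Doubling of variables *)

Section Doubling.
Variable I : finType.
Implicit Types (i j l : I) (w : {set I}).

Definition toggle i w : {set I} := [set l | (l == i) (+) (l \in w)].

Lemma in_toggle i w l : (l \in toggle i w) = (l == i) (+) (l \in w).
Proof. by rewrite inE. Qed.

Lemma toggleK i : involutive (toggle i).
Proof. by move=> w; apply/setP => l; rewrite !in_toggle addbA addbb. Qed.

Lemma toggle_inj i : injective (toggle i).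
Proof. exact: inv_inj (toggleK i). Qed.

Lemma in_toggle_other i w l : l != i -> (l \in toggle i w) = (l \in w).
Proof. by move=> /negbTE li; rewrite in_toggle li. Qed.

Lemma prod_setU_imset (R : realType) (T : finType) (h : T -> T) (S : {set T})
    (F : T -> R) : {in S &, injective h} -> {in S, forall x, h x \notin S} ->
  \prod_(x in S :|: h @: S) F x = \prod_(x in S) F x * \prod_(x in S) F (h x).
Proof.
move=> hI hS; rewrite -(big_imset _ hI) /=.
rewrite (eq_bigl [predU S & h @: S]); last by move=> x; rewrite !inE.
apply: bigU; rewrite disjoint_sym disjoint_subset.
apply/fintype.subsetP => _ /imsetP[x xS ->].
exact: hS.
Qed.

Variables (R : realType) (G : finType).
Implicit Types y : {ffun I * bool -> G}.

(** A set [w] stands for a vertex of the cube {0,1}^I: membership of [i] selects the second copy of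
    the variable [i]. *)
Definition proj w y : {ffun I -> G} := [ffun i => y (i, i \in w)].

Definition flip i y := swap (i, false) (i, true) y.

Lemma proj_flip i w y : proj w (flip i y) = proj (toggle i w) y.
Proof.
apply/ffunP => l; rewrite !ffunE in_toggle !xpair_eqE.
by case: (eqVneq l i) => [->|//]; case: (i \in w).
Qed.

Lemma proj_upd w y i c t :
  proj w (upd y (i, c) t) = if (i \in w) == c then upd (proj w y) i t else proj w y.
Proof.
apply/ffunP => l; case: ifP => ic; rewrite !ffunE xpair_eqE;
  case: (eqVneq l i) => //= ->; rewrite ?ic ?(eqP ic) ?eqxx //.
Qed.

Lemma indep_proj_same (S : Type) i w c (F : {ffun I -> G} -> S) :
  indep i F -> indep (i, c) (fun y => F (proj w y)).
Proof. by move=> Fi y t; rewrite proj_upd; case: ifP => // _; apply: Fi. Qed.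

Lemma indep_proj (S : Type) i w (F : {ffun I -> G} -> S) :
  i \notin w -> indep (i, true) (fun y => F (proj w y)).
Proof. by move=> /negbTE iw y t; rewrite proj_upd iw. Qed.

Lemma flip_upd i l c y t : l != i ->
  flip i (upd y (l, c) t) = upd (flip i y) (l, c) t.
Proof.
move=> li; have il : (i == l) = false by rewrite eq_sym (negbTE li).
apply/ffunP => -[p d]; rewrite !ffunE !xpair_eqE il /=.
by case: (eqVneq p l) => [->|//]; rewrite (negbTE li).
Qed.

Variable nu : I -> {ffun I -> G} -> R.

Definition weights := forall i, indep i (nu i) /\ forall x, 0 <= nu i x.

(** The pair [(i, w)] stands for the factor [nu i] at the vertex [w]; [m] lists the factors with
    exponent one. *)
Definition monomial (m : {set I * {set I}}) y : R :=
  \prod_(p in m) nu p.1 (proj p.2 y).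

(** For [weights], the vertices [w] and [toggle i w] give the same factor of [nu i]. Asking that [i]
    lie outside [w] keeps one of the two, so that no factor is squared. *)
Definition forms_condition (eps : R) :=
  forall m : {set I * {set I}}, (forall p, p \in m -> p.1 \notin p.2) ->
  `|average (monomial m) - 1| <= eps.

Definition box j (Om : {set {set I}}) y : R :=
  \prod_(w in Om) (nu j (proj w y) - 1).

(** Expanding the box gives [2 ^+ #|Om|] monomials, half of them with a minus sign because [Om] is
    nonempty; the main terms cancel and only errors of size [eps] remain. *)
Lemma norm_average_box (eps : R) j (Om : {set {set I}}) (m : {set I * {set I}}) :
  forms_condition eps -> Om != finset.set0 -> {in Om, forall w, j \notin w} ->
  {in m, forall p : I * {set I}, p.1 \notin p.2 /\ p.1 != j} ->
  `|average (fun y => box j Om y * monomial m y)| <= 2 ^+ #|Om| * eps.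
Proof.
move=> lf; have e0 : 0 <= eps.
  by apply: le_trans (lf finset.set0 _) => // p; rewrite inE.
(* The expansion moves factors of [nu j] from the box into the monomial, so the induction admits
   them in [m'] as long as their vertices lie outside [Om']. *)
suff main n : forall (Om' : {set {set I}}) (m' : {set I * {set I}}), (0 < n)%N ->
    #|Om'| = n ->
    {in Om', forall w, j \notin w} ->
    {in m', forall p : I * {set I}, p.1 \notin p.2} ->
    {in m', forall p : I * {set I}, p.1 = j -> p.2 \notin Om'} ->
    `|average (fun y => box j Om' y * monomial m' y)| <= 2 ^+ n * eps.
  move=> Om0 Omj mj; apply: main => //.
  - by rewrite card_gt0.
  - by move=> p /mj[].
  - by move=> p /mj[_ /eqP].
elim: n => // -[|n] IH Om' m' _ cOm Omj mv mj.
  have /cards1P[w Omw] : #|Om'| == 1%N by apply/eqP.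
  have wm : (j, w) \notin m'.
    by apply/negP => /mj /(_ erefl); rewrite Omw inE eqxx.
  have -> : average (fun y => box j Om' y * monomial m' y) =
    (average (monomial ((j, w) |: m')) - 1) - (average (monomial m') - 1).
    rewrite opprB addrA subrK -averageB; apply: eq_average => y.
    by rewrite /box /monomial Omw big_set1 big_setU1 //= mulrBl mul1r.
  rewrite expr1 mulr2n mulrDl mul1r.
  apply: le_trans (ler_normB _ _) _; rewrite lerD ?lf // => p.
  by rewrite !inE => /predU1P[->|/mv//]; rewrite Omj // Omw inE.
have /card_gt0P[w wOm] : (0 < #|Om'|)%N by rewrite cOm.
have wm : (j, w) \notin m' by apply/negP => /mj /(_ erefl); rewrite wOm.
have cOm1 : #|Om' :\ w| = n.+1 by move: cOm; rewrite (cardsD1 w) wOm => -[].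
have Omj1 : {in Om' :\ w, forall w, j \notin w}.
  by move=> v; rewrite !inE => /andP[_]; apply: Omj.
have -> : average (fun y => box j Om' y * monomial m' y) =
    average (fun y => box j (Om' :\ w) y * monomial ((j, w) |: m') y) -
    average (fun y => box j (Om' :\ w) y * monomial m' y).
  rewrite -averageB; apply: eq_average => y.
  by rewrite /box (big_setD1 w) //= /monomial big_setU1 //=; ring.
rewrite exprS mulr2n !mulrDl mul1r.
apply: le_trans (ler_normB _ _) _; rewrite lerD ?IH // => p.
- by rewrite !inE => /predU1P[->|/mv//]; rewrite Omj.
- by rewrite !inE => /predU1P[->|/mj pj /pj]; rewrite ?eqxx // negb_and negbK orbC => ->.
- by move=> pm pj; rewrite !inE negb_and negbK (mj p) ?orbT.
Qed.

End Doubling.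

(** * The weighted Gowers-Cauchy-Schwarz inequality *)

Section Monomials.
Variables (R : realType) (I G : finType) (nu : I -> {ffun I -> G} -> R).

Definition edge (i : I) (S : {set {set I}}) : {set I * {set I}} :=
  [set (i, w) | w in S].

Lemma mem_edge i S (p : I * {set I}) : (p \in edge i S) = (p.1 == i) && (p.2 \in S).
Proof.
case: p => l w; apply/imsetP/andP => /= [[v vS [-> ->]]|[/eqP -> wS]]; first by [].
by exists w.
Qed.

Lemma monomial_edge i S y :
  monomial nu (edge i S) y = \prod_(w in S) nu i (proj w y).
Proof. by rewrite /monomial big_imset //= => v w _ _ []. Qed.

Lemma monomialU (m m' : {set I * {set I}}) y : [disjoint m & m']%B ->
  monomial nu (m :|: m') y = monomial nu m y * monomial nu m' y.
Proof.
move=> mm'; rewrite /monomial (eq_bigl [predU m & m']); first exact: bigU.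
by move=> p; rewrite !inE.
Qed.

End Monomials.

(** Induction on the directions [s] that still carry an arbitrary function [A i]. Cauchy-Schwarz in
    the direction [i] replaces [A i] by its majorant and doubles the variable [i] in all other
    factors; once [s] is exhausted, a box times a monomial is left. The conditions on [s] say that
    its variables are not doubled yet: their second copies do not occur. *)
Lemma weighted_Gowers_Cauchy_Schwarz (R : realType) (I : finType) (s : seq I) :
  uniq s -> forall eta : R, 0 < eta -> exists2 eps : R, 0 < eps &
  forall (G : finType) (nu : I -> {ffun I -> G} -> R), G -> weights nu ->
  forms_condition nu eps ->
  forall (j : I) (Om : {set {set I}}) (m : {set I * {set I}})
    (b : I -> {set {set I}}) (A : I -> {ffun I * bool -> G} -> R),
  j \notin s -> Om != finset.set0 ->
  {in Om, forall w : {set I}, j \notin w /\ {in s, forall i, i \notin w}} ->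
  {in m, forall p : I * {set I},
    [/\ p.1 \notin p.2, p.1 != j, p.1 \notin s & {in s, forall i, i \notin p.2}]} ->
  {in s, forall i, {in b i, forall w : {set I}, {in s, forall l, l \notin w}}} ->
  {in s, forall i y, `|A i y| <= \prod_(w in b i) nu i (proj w y)} ->
  {in s, forall i, indep (i, false) (A i)} ->
  {in s &, forall i l, indep (l, true) (A i)} ->
  `|average (fun y => box nu j Om y * monomial nu m y * \prod_(i <- s) A i y)|
    <= eta.
Proof.
elim: s => [_ eta eta0|i s IH /= /andP[is_ us] eta eta0].
  exists (eta / 2 ^+ #|{set I}|); first by rewrite divr_gt0 ?exprn_gt0.
  move=> G nu t0 nuW lf j Om m b A _ Om0 Omj mj _ _ _ _.
  under eq_average => y do rewrite big_nil mulr1.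
  apply: le_trans (norm_average_box lf Om0 _ _) _.
  - by move=> w /Omj[].
  - by move=> p /mj[].
  rewrite mulrCA ger_pMr // ler_pdivrMr ?exprn_gt0 // mul1r ler_weXn2l ?ler1n //.
  exact: max_card.
(* Cauchy-Schwarz squares the average and costs the factor [average B], which the bound 1 on [eps]
   keeps at most 2; hence [eta ^+ 2 / 2]. *)
have [eps' eps'0 {}IH] := IH us _ (divr_gt0 (exprn_gt0 2 eta0) (ltr0n R 2)).
exists (Num.min eps' 1); first by rewrite lt_min eps'0 ltr01.
move=> G nu t0 nuW lf j Om m b A jis Om0 Omj mj bs AB A0 A1.
have lf' : forms_condition nu eps'.
  by move=> m' /lf /le_trans -> //; rewrite ge_min lexx.
have nu_indep l : indep l (nu l) by have [] := nuW l.
have nu_ge0 l x : 0 <= nu l x by have [] := nuW l.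
have ii : i \in i :: s by rewrite inE eqxx.
have si l : l \in s -> l \in i :: s by rewrite inE orbC => ->.
have iNs l : l \in s -> l != i by move=> ls; apply: contraNneq is_ => <-.
have ij : j != i by apply: contraNneq jis => ->.
pose B (y : {ffun I * bool -> G}) := \prod_(w in b i) nu i (proj w y).
pose H (y : {ffun I * bool -> G}) :=
  box nu j Om y * monomial nu m y * \prod_(l <- s) A l y.
(* The doubled system: every family gains its reflection in the direction [i], and the factors of
   [B] join the monomial. *)
pose Om' := Om :|: toggle i @: Om.
pose sh (p : I * {set I}) : I * {set I} := (p.1, toggle i p.2).
have shI : injective sh by move=> [l v] [l' v'] [-> /toggle_inj ->].
pose m' := (m :|: sh @: m) :|: edge i (b i).
pose b' l := b l :|: toggle i @: b l.
pose A' l y := A l y * A l (flip i y).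
have it (w : {set I}) : i \notin w -> i \in toggle i w.
  by rewrite in_toggle eqxx => /negbTE ->.
have EB2 : average B <= 2.
  have -> : average B = average (monomial nu (edge i (b i))).
    by apply: eq_average => y; rewrite monomial_edge.
  rewrite -lerBlDr; apply: le_trans (ler_norm _) _.
  apply: le_trans (lf _ _) _; last by rewrite ge_min lexx orbT.
  by move=> p; rewrite mem_edge => /andP[/eqP -> /(bs _ ii)]; apply.
have X2 : average (fun y => A i y * H y) ^+ 2 <=
    average B * average (fun y => B y * (H y * H (flip i y))).
  apply: doubling_CauchySchwarz => //.
  - by rewrite xpair_eqE andbF.
  - exact: (A0 _ ii).
  - by apply: indep_prod => w _; apply: indep_proj_same.
  - by apply: indep_prod => w _; apply: indep_proj_same.
  - rewrite /H; apply: indepM; first apply: indepM.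
    + apply: indep_prod => w /Omj[_ /(_ _ ii) iw].
      by move=> y t; rewrite (indep_proj (nu j) iw).
    + by apply: indep_prod => p /mj[_ _ _ /(_ _ ii)]; apply: indep_proj.
    + by move=> y t; rewrite !big_seq; apply: eq_bigr => l ls;
        rewrite (A1 _ _ (si _ ls) ii).
  - exact: (AB _ ii).
have E1 : average (fun y => B y * (H y * H (flip i y))) =
    average (fun y => box nu j Om' y * monomial nu m' y * \prod_(l <- s) A' l y).
  apply: eq_average => y.
  have -> : box nu j Om' y = box nu j Om y * box nu j Om (flip i y).
    rewrite /box /Om' prod_setU_imset.
    - by congr (_ * _); apply: eq_bigr => w _; rewrite proj_flip.
    - by move=> v w _ _; apply: toggle_inj.
    - move=> w wOm; apply/negP => /Omj[_ /(_ _ ii)]; rewrite it //.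
      by have [_ ->] := Omj _ wOm.
  have -> : monomial nu m' y = monomial nu m y * monomial nu m (flip i y) * B y.
    rewrite monomialU ?monomial_edge; last first.
      rewrite disjoint_sym disjoint_subset; apply/fintype.subsetP => p.
      rewrite mem_edge => /andP[/eqP pi _]; rewrite !inE; apply/negP => /orP[/mj[_ _]|].
        by rewrite pi ii.
      by case/imsetP => q /mj[_ _ + _] pq; rewrite -[q.1]/((sh q).1) -pq pi ii.
    congr (_ * _); rewrite /monomial prod_setU_imset.
    - by congr (_ * _); apply: eq_bigr => w _; rewrite proj_flip.
    - by move=> v w _ _; apply: shI.
    - move=> p pm; apply/negP => /mj[_ _ _ /(_ _ ii)]; rewrite it //.
      by have [_ _ _ ->] := mj _ pm.
  rewrite /A' big_split /= /H; ring.
have E2 : average (fun y => box nu j Om' y * monomial nu m' y * \prod_(l <- s) A' l y)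
    <= eta ^+ 2 / 2.
  apply: le_trans (ler_norm _) _; apply: (IH _ _ t0 nuW lf' _ _ _ b') => //.
  - by apply: contraNN jis; apply: si.
  - have /set0Pn[w wOm] := Om0; apply/set0Pn; exists w; by rewrite inE wOm.
  - move=> w; rewrite inE => /orP[/Omj[jw ws]|/imsetP[v /Omj[jv vs] ->]].
      by split=> // l /si; apply: ws.
    by split=> [|l ls]; rewrite in_toggle_other // ?vs ?si ?iNs.
  - move=> p; rewrite !inE -orbA.
    move=> /or3P[/mj[pp pj ps sp]|/imsetP[q /mj[qq qj qs sq] ->]|].
    + split=> // [|l /si]; [by apply: contraNN ps; apply: si|exact: sp].
    + split=> //=.
      * by rewrite in_toggle_other //; apply: contraNneq qs => ->.
      * by apply: contraNN qs; apply: si.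
      * by move=> l ls; rewrite in_toggle_other ?iNs ?sq ?si.
    + rewrite mem_edge => /andP[/eqP -> pb]; split => //; first exact: (bs i ii).
        by rewrite eq_sym.
      by move=> l /si; apply: (bs i ii).
  - move=> l ls w; rewrite inE => /orP[wb q /si|/imsetP[v vb ->] q qs].
      by apply: (bs l (si _ ls)).
    by rewrite in_toggle_other ?iNs // (bs l (si _ ls)) ?si.
  - move=> l ls y; rewrite normrM prod_setU_imset.
    + rewrite ler_pM ?AB ?si //; apply: le_trans (AB _ (si _ ls) _) _.
      by apply: ler_prod => w _; rewrite proj_flip nu_ge0 lexx.
    + by move=> v w _ _; apply: toggle_inj.
    + move=> w wb; apply/negP => /(bs _ (si _ ls)) /(_ _ ii).
      by rewrite it // (bs _ (si _ ls)).
  - by move=> l ls y t; rewrite /A' flip_upd ?iNs // !A0 ?si.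
  - by move=> l q ls qs y t; rewrite /A' flip_upd ?iNs // !A1 ?si.
have B0 : 0 <= average B by apply: average_ge0 => y; apply: prodr_ge0.
rewrite -(ler_pXn2r (ltn0Sn 1)) ?nnegrE ?normr_ge0 ?(ltW eta0) // real_normK ?num_real //.
have -> : average (fun y => box nu j Om y * monomial nu m y * \prod_(l <- i :: s) A l y) =
    average (fun y => A i y * H y).
  by apply: eq_average => y; rewrite big_cons mulrCA.
apply: le_trans X2 _; rewrite E1; apply: le_trans (ler_wpM2l B0 E2) _.
by rewrite mulrCA ger_pMr ?exprn_gt0 // ler_pdivrMr // mul1r.
Qed.

(** * Densification *)

Section Densification.
Variables (R : realType) (I G : finType).
Implicit Types (i j : I) (x : {ffun I -> G}) (h : {ffun I -> G} -> R).
Implicit Types (a c f g : I -> {ffun I -> G} -> R).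

Definition densify j f x : R :=
  average (fun t => \prod_(i | i != j) f i (upd x j t)).

Definition cut_le j h (e : R) :=
  forall u : I -> {ffun I -> G} -> R,
    (forall i, indep i (u i)) -> (forall i x, `|u i x| <= 1) ->
  `|average (fun x => h x * \prod_(i | i != j) u i x)| <= e.

Hypothesis t0 : G.

Lemma indep_densify j f : indep j (densify j f).
Proof.
by move=> x t; apply: eq_average => s; apply: eq_bigr => i _; rewrite upd_upd.
Qed.

Lemma average_densify j h f : indep j h ->
  average (fun x => h x * densify j f x) =
  average (fun x => h x * \prod_(i | i != j) f i x).
Proof. by move=> hj; rewrite [RHS](average_updM (a := j)). Qed.

Lemma average_proj_pair (F : {ffun I * bool -> G} -> R) :
  average F = average (fun x => average (fun x' : {ffun I -> G} =>
    F [ffun p => if p.2 then x' p.1 else x p.1])).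
Proof.
pose jn (p : {ffun I -> G} * {ffun I -> G}) : {ffun I * bool -> G} :=
  [ffun q => if q.2 then p.2 q.1 else p.1 q.1].
have jnB : bijective jn.
  exists (fun y : {ffun I * bool -> G} =>
      ([ffun i => y (i, false)], [ffun i => y (i, true)])).
    by move=> [x x']; congr (_, _); apply/ffunP => i; rewrite !ffunE.
  by move=> y; apply/ffunP => -[i []]; rewrite !ffunE.
by rewrite (average_bij F jnB) average_pair.
Qed.

Lemma average_proj0 h :
  average (fun y : {ffun I * bool -> G} => h (proj finset.set0 y)) = average h.
Proof.
rewrite average_proj_pair; apply: eq_average => x.
rewrite -[RHS](average_cst _ ([ffun=> t0] : {ffun I -> G})).
by apply: eq_average => x'; congr h; apply/ffunP => i; rewrite !ffunE inE.
Qed.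

Lemma average_coord j (K : G -> R) :
  average (fun x => K (x j)) = average K.
Proof.
rewrite (average_upd j) // -[RHS](average_cst _ ([ffun=> t0] : {ffun I -> G})).
by apply: eq_average => x; apply: eq_average => t; rewrite upd_same.
Qed.

(** The two densified functions share every coordinate but [j], for which they use independent
    samples; thus only the vertices [set0] and [[set j]] occur. *)
Lemma average_densify2 j h a c : indep j h ->
  average (fun x => h x * densify j a x * densify j c x) =
  average (fun y : {ffun I * bool -> G} => h (proj finset.set0 y) *
    (\prod_(i | i != j) a i (proj finset.set0 y) *
     \prod_(i | i != j) c i (proj [set j] y))).
Proof.
move=> hj; rewrite [RHS]average_proj_pair.
under eq_average => x do rewrite mulrAC.
rewrite average_densify; last by apply: indepM => //; apply: indep_densify.
apply: eq_average => x.
have -> : h x * densify j c x * \prod_(i | i != j) a i x =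
    h x * (\prod_(i | i != j) a i x * densify j c x) by ring.
rewrite /densify -(average_coord j (fun t => \prod_(i | i != j) c i (upd x j t))).
rewrite -!averageZ; apply: eq_average => x'.
set y := finfun _.
have -> : proj finset.set0 y = x by apply/ffunP => i; rewrite !ffunE inE.
suff -> : proj [set j] y = upd x j (x' j) by [].
by apply/ffunP => i; rewrite !ffunE inE /=; case: eqP => [->|].
Qed.

Lemma ler_densify j f g : (forall i x, i != j -> 0 <= f i x <= g i x) ->
  forall x, densify j f x <= densify j g x.
Proof.
move=> fg x; apply: ler_average => t; apply: ler_prod => i ij; exact: fg.
Qed.

Lemma densify_ge0 j f : (forall i x, i != j -> 0 <= f i x) ->
  forall x, 0 <= densify j f x.
Proof. by move=> f0 x; apply: average_ge0 => t; apply: prodr_ge0 => i /f0. Qed.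

Lemma densify1 j x : densify j (fun _ _ => 1) x = 1.
Proof.
by rewrite /densify -[RHS](average_cst 1 t0); apply: eq_average => t; rewrite big1.
Qed.

End Densification.

Section Majorant.
Variables (R : realType) (I G : finType) (nu : I -> {ffun I -> G} -> R).

(* The majorants of a mixed system, in which only the edges of M are unbounded. *)
Definition majorant (M : {set I}) i x := if i \in M then nu i x else 1.

Definition layer (S w : {set I}) : {set I * {set I}} := [set (i, w) | i in S].

Lemma prod_majorant M j w (y : {ffun I * bool -> G}) :
  \prod_(i | i != j) majorant M i (proj w y) = monomial nu (layer (M :\ j) w) y.
Proof.
rewrite /monomial big_imset /=; last by move=> i l _ _ [].
by rewrite -big_mkcondr; apply: eq_bigl => i; rewrite !inE.
Qed.

Lemma layer_forms M j (w : {set I}) : (forall i, i \in w -> i = j) ->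
  forall p, p \in layer (M :\ j) w -> p.1 \notin p.2.
Proof.
move=> wj p /imsetP[i + ->] /=; rewrite !inE => /andP[ij _].
by apply: contraNN ij => /wj ->.
Qed.

(** The first two moments of the densified majorant are averages of monomials, each within [eps] of
    1, and they enter the variance with coefficients -2 and 1. *)
Lemma densify_majorant_variance (eps : R) M j : G -> forms_condition nu eps ->
  average (fun x => (densify j (majorant M) x - 1) ^+ 2) <= 3 * eps.
Proof.
move=> t0 lf; set d := densify j _.
pose m0 := layer (M :\ j) finset.set0; pose m1 := layer (M :\ j) [set j].
have m0P p : p \in m0 -> p.1 \notin p.2.
  by apply: layer_forms => i; rewrite inE.
have m1P p : p \in m1 -> p.1 \notin p.2 by apply: layer_forms => i; rewrite inE => /eqP.
have d1 : average d = average (monomial nu m0).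
  have -> : average d = average (fun x => 1 * d x * densify j (fun _ _ => 1) x).
    by apply: eq_average => x; rewrite densify1 // mulr1 mul1r.
  rewrite average_densify2 //; apply: eq_average => y.
  by rewrite prod_majorant mul1r [X in _ * X]big1 ?mulr1.
have d2 : average (fun x => d x ^+ 2) = average (monomial nu (m0 :|: m1)).
  have -> : average (fun x => d x ^+ 2) = average (fun x => 1 * d x * d x).
    by apply: eq_average => x; rewrite mul1r expr2.
  rewrite average_densify2 //; apply: eq_average => y.
  rewrite mul1r !prod_majorant monomialU //.
  rewrite disjoint_subset; apply/fintype.subsetP => p /imsetP[i _ ->].
  rewrite inE; apply/imsetP => -[l _ [_ /setP /(_ j)]].
  by rewrite !inE eqxx.
have -> : average (fun x => (d x - 1) ^+ 2) =
    (average (monomial nu (m0 :|: m1)) - 1) - 2 * (average (monomial nu m0) - 1).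
  have -> : average (fun x => (d x - 1) ^+ 2) =
      average (fun x => d x ^+ 2 + (- 2) * d x + 1).
    by apply: eq_average => x; ring.
  rewrite !averageD averageZ d2 d1 average_cst; last exact: [ffun=> t0].
  by ring.
have := lf m0 m0P; have := lf (m0 :|: m1).
have mP p : p \in m0 :|: m1 -> p.1 \notin p.2.
  by rewrite inE => /orP[/m0P|/m1P].
move=> /(_ mP); rewrite !ler_norml => /andP[_ h1] /andP[h2 _]; lra.
Qed.

End Majorant.

(** Unfolding both densifications gives a box with the single factor [nu j - 1] times functions on
    the edges [i != j]; these are removed by the Gowers-Cauchy-Schwarz inequality with all
    directions but [j] in [s]. *)
Lemma weight_pseudorandom (R : realType) (I : finType) (eta : R) : 0 < eta ->
  exists2 eps : R, 0 < eps &
  forall (G : finType) (nu : I -> {ffun I -> G} -> R), G -> weights nu ->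
  forms_condition nu eps ->
  forall (j : I) (M N : {set I}) (a c : I -> {ffun I -> G} -> R),
  (forall i, indep i (a i)) -> (forall i, indep i (c i)) ->
  (forall i x, `|a i x| <= majorant nu M i x) ->
  (forall i x, `|c i x| <= majorant nu N i x) ->
  `|average (fun x => (nu j x - 1) * densify j a x * densify j c x)| <= eta.
Proof.
move=> eta0.
pose good j eps := 0 < eps /\ forall (G : finType)
    (nu : I -> {ffun I -> G} -> R), G -> weights nu -> forms_condition nu eps ->
  forall (M N : {set I}) (a c : I -> {ffun I -> G} -> R),
  (forall i, indep i (a i)) -> (forall i, indep i (c i)) ->
  (forall i x, `|a i x| <= majorant nu M i x) ->
  (forall i x, `|c i x| <= majorant nu N i x) ->
  `|average (fun x => (nu j x - 1) * densify j a x * densify j c x)| <= eta.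
have goodj j : exists eps, good j eps.
  have [eps eps0 gcs] :=
    weighted_Gowers_Cauchy_Schwarz (enum_uniq (predC1 j)) eta0.
  exists eps; split=> // G nu t0 nuW lf M N a c aI cI aM cM.
  rewrite average_densify2 //; last by move=> x t; rewrite (nuW j).1.
  (* [b i] collects the vertices at which [nu i] is needed as a bound: [set0] for [a i] and
     [[set j]] for [c i]. *)
  pose b i : {set {set I}} :=
    (if i \in M then [set finset.set0]%SET else finset.set0) :|:
    (if i \in N then [set [set j]]%SET else finset.set0).
  pose A i (y : {ffun I * bool -> G}) :=
    a i (proj finset.set0 y) * c i (proj [set j] y).
  have sj i : (i \in enum (predC1 j)) = (i != j) by rewrite mem_enum inE.
  have -> : average (fun y => (nu j (proj finset.set0 y) - 1) *
     (\prod_(i | i != j) a i (proj finset.set0 y) *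
      \prod_(i | i != j) c i (proj [set j] y))) =
     average (fun y => box nu j [set finset.set0] y * monomial nu finset.set0 y *
       \prod_(i <- enum (predC1 j)) A i y).
    apply: eq_average => y; rewrite /box big_set1 /monomial big_set0 mulr1.
    by rewrite big_enum /= -big_split.
  apply: (gcs G nu t0 nuW lf _ _ _ b).
  - by rewrite sj eqxx.
  - by apply/set0Pn; exists finset.set0; rewrite inE.
  - by move=> w /set1P ->; rewrite inE; split=> // i _; rewrite inE.
  - by move=> p; rewrite inE.
  - move=> i _ w wb l; rewrite sj => lj.
    have : w = finset.set0 \/ w = [set j]%SET.
      by move: wb; rewrite /b inE => /orP[]; case: ifP => _;
        rewrite inE // => /eqP ->; auto.
    by case=> ->; rewrite inE.
  - move=> i ij y; rewrite normrM /b.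
    have := (aM i (proj finset.set0 y), cM i (proj [set j] y)).
    have j0 : [set j]%SET != finset.set0 :> {set I}.
      by apply/set0Pn; exists j; rewrite inE.
    rewrite /majorant; case: ifP => _; case: ifP => _ [ha hc];
      rewrite ?finset.setU0 ?finset.set0U ?big_setU1 ?inE 1?eq_sym //
        ?big_set1 ?big_set0 /=.
    + exact: ler_pM.
    + by rewrite -[leRHS]mulr1 ler_pM.
    + by rewrite -[leRHS]mul1r ler_pM.
    + by rewrite mulr_ile1.
  - move=> i; rewrite sj => ij; apply: indepM; exact: indep_proj_same.
  - move=> i l; rewrite !sj => ij lj; apply: indepM; apply: indep_proj; by rewrite inE.
have /choice[eps epsP] := goodj.
exists (\big[Num.min/1]_j eps j).
  by apply: lt_bigmin => // j _; have [] := epsP j.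
move=> G nu t0 nuW lf j; have [_ gj] := epsP j; apply: gj => // m mP.
by apply: le_trans (lf m mP) _; apply: bigmin_le_cond.
Qed.

(** * The relative counting lemma *)

Lemma prod_in01 (R : realType) (I : Type) (r : seq I) (P : pred I) (F : I -> R) :
  (forall i, P i -> 0 <= F i <= 1) -> 0 <= \prod_(i <- r | P i) F i <= 1.
Proof.
move=> F01; apply: (big_ind (fun x => 0 <= x <= 1)) => //; first by rewrite ler01 lexx.
by move=> x y /andP[x0 x1] /andP[y0 y1]; rewrite mulr_ge0 // mulr_ile1.
Qed.

Section BoundedCounting.
Variables (R : realType) (I G : finType) (e : R).
Variables (f g : I -> {ffun I -> G} -> R).
Hypotheses (fI : forall i, indep i (f i)) (gI : forall i, indep i (g i)).
Hypotheses (f01 : forall i x, 0 <= f i x <= 1) (g01 : forall i x, 0 <= g i x <= 1).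
Hypothesis fg : forall i, cut_le i (fun x => f i x - g i x) e.

(** The factors [g i] are traded for [f i] one at a time. At each step the remaining factors are
    bounded and each ignores its own coordinate, so they form an admissible test for the cut
    norm. *)
Lemma bounded_counting :
  `|average (fun x => \prod_i f i x) - average (fun x => \prod_i g i x)|
    <= #|I|%:R * e.
Proof.
pose h (s : seq I) i x := if i \in s then f i x else g i x.
have telescope s : uniq s ->
    `|average (fun x => \prod_i h s i x) - average (fun x => \prod_i g i x)|
      <= (size s)%:R * e.
  elim: s => [_|i s IH /= /andP[is_ us]].
    by rewrite mul0r (eq_average (H := fun x => \prod_i g i x)) ?subrr ?normr0.
  rewrite (_ : _ - _ = average (fun x => (f i x - g i x) * \prod_(l | l != i) h s l x)
      + (average (fun x => \prod_i h s i x) - average (fun x => \prod_i g i x))).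
    rewrite -natr1 mulrDl mul1r [leRHS]addrC; apply: le_trans (ler_normD _ _) _.
    apply: lerD; last exact: IH.
    apply: fg => [l x t|l x]; rewrite /h; case: ifP => _; rewrite ?fI ?gI //.
      by have /andP[h0 h1] := f01 l x; rewrite ger0_norm.
    by have /andP[h0 h1] := g01 l x; rewrite ger0_norm.
  rewrite addrA; congr (_ - _); rewrite -averageD; apply: eq_average => x.
  rewrite (bigD1 i) //= [in RHS](bigD1 i (P := xpredT)) //=.
  rewrite /h mem_head (negbTE is_) (eq_bigr (h s ^~ x)); first by rewrite /h; ring.
  by move=> l li; rewrite /h inE (negbTE li).
have := telescope (enum I) (enum_uniq _); rewrite -cardE.
by rewrite (eq_average (H := fun x => \prod_i f i x)) // => x;
  apply: eq_bigr => i _; rewrite /h mem_enum.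
Qed.

End BoundedCounting.

Section CountingStep.
Variables (R : realType) (I G : finType) (nu : I -> {ffun I -> G} -> R).
Hypothesis t0 : G.
Variables (eps theta kappa : R) (M : {set I}) (j : I).
Hypotheses (eps1 : eps <= 1) (theta0 : 0 < theta).
Hypothesis lf : forms_condition nu eps.
Variables (f g : I -> {ffun I -> G} -> R).
Hypotheses (fI : forall i, indep i (f i)) (gI : forall i, indep i (g i)).
Hypothesis g01 : forall i x, 0 <= g i x <= 1.
Hypothesis fM : forall i x, 0 <= f i x <= majorant nu M i x.

Let f' := densify j f.
Let g' := densify j g.
Let d := densify j (majorant nu M).
(* f' need not be bounded by 1, but it is majorized by d, which is 1 on average
   in the L2 sense. *)
Let p x := Num.min (f' x) 1.

Hypothesis pseudorandom : forall a c : I -> {ffun I -> G} -> R,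
  (a = f \/ a = g) -> (c = f \/ c = g) ->
  `|average (fun x => (nu j x - 1) * densify j a x * densify j c x)| <= kappa.
(** Both counting hypotheses come from the induction: putting the bounded function [p] or [g'] on
    the edge [j] leaves one unbounded edge fewer. *)
Hypothesis counting_p :
  `|average (fun x => p x * f' x) - average (fun x => p x * g' x)| <= theta.
Hypothesis counting_g :
  `|average (fun x => g' x * f' x) - average (fun x => g' x * g' x)| <= theta.
Hypothesis cut_j : cut_le j (fun x => f j x - g j x) eps.
Hypothesis jM : j \in M.

(** The square splits into [(f' - g') * (f' - p)] and two differences of counts, each at most
    [theta]. The product vanishes unless [f' > 1], where it is at most [d * (d - 1)]; the
    arithmetic-geometric mean inequality turns this into [theta] plus a multiple of the variance of
    [d]. *)
Lemma densified_counting_step :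
  average (fun x => (f' x - g' x) ^+ 2) <=
    3 * theta + 3 * (theta^-1 + 1) * eps.
Proof.
have var := densify_majorant_variance M j t0 lf; rewrite -/d in var.
have f'0 x : 0 <= f' x by apply: densify_ge0 => i y _; have /andP[] := fM i y.
have f'd x : f' x <= d x by apply: ler_densify.
have g'0 x : 0 <= g' x by apply: densify_ge0 => i y _; have /andP[] := g01 i y.
have g'1 x : g' x <= 1.
  rewrite -[leRHS](densify1 R t0 j x); apply: ler_densify => i y _; exact: g01.
have pointwise x : (f' x - g' x) ^+ 2 <=
    (theta + (theta^-1 + 1) * (d x - 1) ^+ 2) +
    ((p x * f' x - p x * g' x) - (g' x * f' x - g' x * g' x)).
  have -> : (f' x - g' x) ^+ 2 = (f' x - g' x) * (f' x - p x) +
      ((p x * f' x - p x * g' x) - (g' x * f' x - g' x * g' x)) by ring.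
  rewrite lerD2r.
  have amgm : 2 * `|d x - 1| <= theta + theta^-1 * (d x - 1) ^+ 2.
    rewrite -(real_normK (num_real (d x - 1))); set t := `|_|.
    rewrite -subr_ge0 (_ : _ - _ = theta^-1 * (theta - t) ^+ 2); last first.
      by field; rewrite gt_eqF.
    by rewrite mulr_ge0 ?invr_ge0 ?sqr_ge0 // ltW.
  apply: le_trans (_ : _ <= 2 * `|d x - 1| + (d x - 1) ^+ 2) _; last first.
    by rewrite (mulrDl theta^-1) mul1r addrA lerD2r.
  have := f'd x; have := g'0 x; have := ler_norm (d x - 1).
  rewrite /p; case: (leP (f' x) 1) => [_ dn _ _|f'1 dn g0 fd].
    by rewrite subrr mulr0 addr_ge0 ?sqr_ge0 // mulr_ge0.
  have : (f' x - g' x) * (f' x - 1) <= d x * (d x - 1).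
    have := g'1 x => g1.
    by rewrite ler_pM ?subr_ge0 ?(le_trans g1) ?(ltW f'1) // ?lerB // lerBlDr ler_wpDr.
  nra.
apply: le_trans (ler_average pointwise) _.
rewrite averageD averageD averageZ !averageB average_cst;
  last exact: [ffun=> t0].
move: counting_p counting_g; rewrite !ler_norml => /andP[_ cp] /andP[cg _].
have : (theta^-1 + 1) * average (fun x => (d x - 1) ^+ 2) <= (theta^-1 + 1) * (3 * eps).
  by rewrite ler_wpM2l // addr_ge0 ?invr_ge0 ?ltW.
lra.
Qed.

(** The cut norm controls the average of [(f j - g j) * g']. What remains is the average of
    [f j * (f' - g')], treated by Cauchy-Schwarz with weight [f j], whose average is at most 2. Then
    [f j] is raised to [nu j], and replacing [nu j] by 1 costs [4 * kappa], from the coefficients 1,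
    2, 1 of the square. *)
Lemma counting_step :
  `|average (fun x => \prod_i f i x) - average (fun x => \prod_i g i x)| <=
  eps + Num.sqrt (2 * (4 * kappa + 3 * theta + 3 * (theta^-1 + 1) * eps)).
Proof.
have f0 i x : 0 <= f i x by have /andP[] := fM i x.
have split_j (a : I -> {ffun I -> G} -> R) : (forall i, indep i (a i)) ->
    average (fun x => \prod_i a i x) = average (fun x => a j x * densify j a x).
  move=> aI; rewrite average_densify //; apply: eq_average => x.
  by rewrite (bigD1 j).
rewrite (_ : _ - _ = average (fun x => (f j x - g j x) * \prod_(i | i != j) g i x)
    + average (fun x => f j x * (f' x - g' x))); last first.
  rewrite -average_densify //; last by move=> x t; rewrite fI gI.
  rewrite !split_j // -averageB -averageD; apply: eq_average => x.
  by rewrite -/f' -/g'; ring.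
apply: le_trans (ler_normD _ _) _; apply: lerD.
  by apply: cut_j => // i x; have /andP[h0 h1] := g01 i x; rewrite ger0_norm.
rewrite -sqrtr_sqr ler_wsqrtr //.
apply: le_trans (average_CauchySchwarz _ (f0 j)) _.
have Q0 : 0 <= average (fun x => f j x * (f' x - g' x) ^+ 2).
  by apply: average_ge0 => x; rewrite mulr_ge0 ?sqr_ge0.
have fnu x : f j x <= nu j x by have /andP[_] := fM j x; rewrite /majorant jM.
have Ef : average (f j) <= 2.
  apply: le_trans (ler_average fnu) _; rewrite -lerBlDr.
  have -> : average (nu j) = average (monomial nu [set (j, finset.set0)]).
    rewrite -(average_proj0 t0); apply: eq_average => y.
    by rewrite /monomial big_set1.
  apply: le_trans (ler_norm _) _; apply: le_trans eps1; apply: lf.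
  by move=> q /set1P ->; rewrite inE.
apply: le_trans (ler_wpM2r Q0 Ef) _; rewrite ler_pM2l //.
apply: le_trans (_ : _ <= average (fun x => nu j x * (f' x - g' x) ^+ 2)) _.
  by apply: ler_average => x; rewrite ler_wpM2r ?sqr_ge0.
have -> : average (fun x => nu j x * (f' x - g' x) ^+ 2) =
    average (fun x => (nu j x - 1) * f' x * f' x) -
    2 * average (fun x => (nu j x - 1) * f' x * g' x) +
    average (fun x => (nu j x - 1) * g' x * g' x) +
    average (fun x => (f' x - g' x) ^+ 2).
  rewrite -averageZ -averageB -!averageD; apply: eq_average => x; ring.
have := densified_counting_step.
have ff : f = f \/ f = g by left. have gg : g = f \/ g = g by right.
have := pseudorandom ff ff; have := pseudorandom ff gg; have := pseudorandom gg gg.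
rewrite !ler_norml -/f' -/g' => /andP[_ h1] /andP[h2 _] /andP[_ h3]; lra.
Qed.

End CountingStep.

Section Replace.
Variables (R : realType) (I G : finType) (t0 : G) (j : I).
Implicit Types (h : {ffun I -> G} -> R) (a : I -> {ffun I -> G} -> R).

Definition replace h a i := if i == j then h else a i.

Lemma average_replace h a : indep j h ->
  average (fun x => h x * densify j a x) =
  average (fun x => \prod_i replace h a i x).
Proof.
move=> hj; rewrite average_densify //; apply: eq_average => x.
rewrite [RHS](bigD1 j) //= {1}/replace eqxx; congr (_ * _).
by apply: eq_bigr => i /negbTE ij; rewrite /replace ij.
Qed.

End Replace.

Lemma ler_cut (R : realType) (I G : finType) (j : I) (h : {ffun I -> G} -> R) e e' :
  e <= e' -> cut_le j h e -> cut_le j h e'.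
Proof. by move=> ee' he u uI u1; apply: le_trans ee'; apply: he. Qed.

Lemma ler_forms (R : realType) (I G : finType) (nu : I -> {ffun I -> G} -> R) e e' :
  e <= e' -> forms_condition nu e -> forms_condition nu e'.
Proof. by move=> ee' lf m mP; apply: le_trans ee'; apply: lf. Qed.

(** Induction on the number of unbounded edges: [counting_step] treats one edge [j] of [M], and the
    counts it needs are those with a bounded function on [j]. *)
Lemma relative_counting (R : realType) (I : finType) (n : nat) (eta : R) :
  0 < eta -> exists2 eps : R, 0 < eps &
  forall (G : finType) (nu : I -> {ffun I -> G} -> R), G -> weights nu ->
  forms_condition nu eps ->
  forall (M : {set I}) (f g : I -> {ffun I -> G} -> R),
  (#|M| <= n)%N ->
  (forall i, indep i (f i)) -> (forall i, indep i (g i)) ->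
  (forall i x, 0 <= g i x <= 1) -> (forall i x, 0 <= f i x <= majorant nu M i x) ->
  (forall i, cut_le i (fun x => f i x - g i x) eps) ->
  `|average (fun x => \prod_i f i x) - average (fun x => \prod_i g i x)| <= eta.
Proof.
elim: n eta => [|n IH] eta eta0.
  exists (eta / #|I|.+1%:R); first by rewrite divr_gt0 ?ltr0n.
  move=> G nu t0 nuW lf M f g M0 fI gI g01 fM fg.
  have f01 i x : 0 <= f i x <= 1.
    have := fM i x; rewrite /majorant.
    by move: M0; rewrite leqn0 cards_eq0 => /eqP ->; rewrite inE.
  apply: le_trans (bounded_counting fI gI f01 g01 fg) _.
  by rewrite mulrCA ger_pMr // ler_pdivrMr ?ltr0n // mul1r ler_nat.
(* With [kappa = theta] and [3 * (theta^-1 + 1) * eps <= theta], the quantity under the root in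
   [counting_step] is at most [16 * theta], the square of [eta / 2]. *)
pose theta := eta ^+ 2 / 64; have theta0 : 0 < theta by rewrite divr_gt0 ?exprn_gt0.
have [eps0 eps0_gt0 IH0] := IH _ eta0.
have [eps1 eps1_gt0 {}IH] := IH _ theta0.
have [eps2 eps2_gt0 pseudo] := weight_pseudorandom I theta0.
pose c := 3 * (theta^-1 + 1).
have c0 : 0 < c by rewrite mulr_gt0 // addr_gt0 ?invr_gt0.
pose eps3 := Num.min (eta / 2) (Num.min (theta / c) 1).
pose eps := Num.min eps0 (Num.min eps1 (Num.min eps2 eps3)).
have eps_gt0 : 0 < eps.
  by rewrite !lt_min eps0_gt0 eps1_gt0 eps2_gt0 (divr_gt0 eta0) //
    (divr_gt0 theta0) // ltr01.
exists eps => // G nu t0 nuW lf M f g Mn fI gI g01 fM fg.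
have le0 : eps <= eps0 by rewrite !ge_min lexx.
have le1 : eps <= eps1 by rewrite !ge_min lexx orbT.
have le2 : eps <= eps2 by rewrite !ge_min lexx !orbT.
have le3 : eps <= eta / 2 by rewrite !ge_min lexx !orbT.
have le4 : eps <= theta / c by rewrite !ge_min lexx !orbT.
have le5 : eps <= 1 by rewrite !ge_min lexx !orbT.
have lf1 := ler_forms le1 lf; have lf2 := ler_forms le2 lf.
have fg1 i := ler_cut le1 (fg i).
have [M0|[j jM]] := set_0Vmem M.
  apply: (IH0 G nu t0 nuW (ler_forms le0 lf) M) => // [|i]; first by rewrite M0 cards0.
  exact: ler_cut le0 (fg i).
have Mj : (#|M :\ j| <= n)%N by move: Mn; rewrite (cardsD1 j) jM.
have f0 i x : 0 <= f i x by have /andP[] := fM i x.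
have replaced h : indep j h -> (forall x, 0 <= h x <= 1) ->
    `|average (fun x => h x * densify j f x) -
      average (fun x => h x * densify j g x)| <= theta.
  move=> hI h01; rewrite !average_replace //.
  apply: (IH G nu t0 nuW lf1 (M :\ j)) => // i.
  - by rewrite /replace; case: eqP => [->|].
  - by rewrite /replace; case: eqP => [->|].
  - by move=> x; rewrite /replace; case: eqP.
  - move=> x; rewrite /replace /majorant !inE; case: eqP => //= _; exact: fM.
  - rewrite /replace; case: eqP => // _ u uI u1.
    rewrite (eq_average (H := fun _ => 0)); last by move=> x; rewrite subrr mul0r.
    by rewrite (average_cst _ ([ffun=> t0] : {ffun I -> G})) normr0 ltW.
have pseudo_fg (a b : I -> {ffun I -> G} -> R) : a = f \/ a = g -> b = f \/ b = g ->
    `|average (fun x => (nu j x - 1) * densify j a x * densify j b x)| <= theta.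
  move=> aE bE; have mixed e : e = f \/ e = g -> (forall i, indep i (e i)) /\
      exists N, forall i x, `|e i x| <= majorant nu N i x.
    case=> ->; split=> //.
      by exists M => i x; rewrite ger0_norm //; have /andP[] := fM i x.
    exists finset.set0 => i x; rewrite /majorant inE.
    by have /andP[g0 g1] := g01 i x; rewrite ger0_norm.
  have [aI [N aN]] := mixed _ aE; have [bI [N' bN']] := mixed _ bE.
  exact: (pseudo G nu t0 nuW lf2 j N N').
pose p x := Num.min (densify j f x) 1.
have pI : indep j p by move=> x t; rewrite /p indep_densify.
have p01 x : 0 <= p x <= 1.
  rewrite ge_min lexx orbT andbT le_min ler01 andbT.
  by apply: densify_ge0.
have g'01 x : 0 <= densify j g x <= 1.
  apply/andP; split.
    by apply: densify_ge0 => i y _; have /andP[] := g01 i y.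
  by rewrite -[leRHS](densify1 R t0 j x); apply: ler_densify => i y _; exact: g01.
have := counting_step t0 le5 theta0 lf fI gI g01 fM pseudo_fg
  (replaced _ pI p01) (replaced _ (@indep_densify _ _ _ j g) g'01) (fg j) jM.
move=> /le_trans; apply.
rewrite [leRHS]splitr; apply: lerD => //.
have e2 : 0 <= eta / 2 by rewrite divr_ge0 // ltW.
rewrite -[leRHS]ger0_norm // -sqrtr_sqr ler_wsqrtr //.
have : c * eps <= theta by rewrite mulrC -ler_pdivlMr.
rewrite -/c /theta => h; lra.
Qed.

(** * The dense model theorem *)

Section ScalarLemmas.
Variable R : realType.
Implicit Types x u : R.

(* The Newton iterates for the square root of x ^+ 2: polynomials in x that
   converge to |x| uniformly on [-1, 1]. *)
Fixpoint newton_abs n x : R :=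
  if n is n'.+1 then
    newton_abs n' x + 2^-1 * (x ^+ 2 - newton_abs n' x ^+ 2)
  else 0.

(** One iteration turns the error [e = a - q] into [e * (1 - (a + q) / 2)], at most
    [e * (1 - e / 2)]. The latter increases on [0, 1] and maps 2/(n+2) below 2/(n+3). *)
Lemma newton_absP n x : `|x| <= 1 ->
  0 <= newton_abs n x <= `|x| /\ `|x| - newton_abs n x <= 2 / n.+2%:R.
Proof.
move=> x1; rewrite (_ : newton_abs n x = newton_abs n `|x|); last first.
  by elim: n => //= n ->; rewrite real_normK ?num_real.
have := normr_ge0 x; set a := `|x| in x1 *; move=> a0.
elim: n => [|n [/andP[q0 qa] IH]] /=.
  by rewrite lexx a0 subr0 divff ?pnatr_eq0.
set q := newton_abs n a in q0 qa IH *.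
have n0 : 0 < n.+2%:R :> R by rewrite ltr0n.
have n1 : 0 < n.+3%:R :> R by rewrite ltr0n.
split; first by nra.
set e := a - q in IH.
apply: le_trans (_ : _ <= e * (1 - e / 2)) _; first by rewrite /e; nra.
have eN : 2 / n.+2%:R <= 1 :> R by rewrite ler_pdivrMr // mul1r ler_nat.
apply: le_trans (_ : _ <= 2 / n.+2%:R * (1 - (2 / n.+2%:R) / 2)) _.
  set N := 2 / n.+2%:R in IH eN *.
  rewrite -subr_ge0 (_ : _ - _ = (N - e) * (1 - (N + e) / 2)); last by field.
  by apply: mulr_ge0; rewrite /e in IH *; lra.
rewrite -subr_ge0 -[n.+3]addn1 natrD.
rewrite (_ : _ - _ = 2 * (n.+2%:R ^+ 2 * (n.+2%:R + 1))^-1); last first.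
  have nn : 0 <= n%:R :> R := ler0n R n.
  by field; apply/andP; split; rewrite gt_eqF //; lra.
by rewrite mulr_ge0 // invr_ge0 mulr_ge0 ?sqr_ge0 // addr_ge0 // ltW.
Qed.

Definition clip x : R := Num.max 0 (Num.min 1 x).

Lemma clip01 x : 0 <= clip x <= 1.
Proof. by rewrite le_max lexx ge_max ler01 ge_min lexx. Qed.

Lemma clip_nonexpansive x u : 0 <= u <= 1 -> (clip x - u) ^+ 2 <= (x - u) ^+ 2.
Proof.
move=> /andP[u0 u1]; rewrite -subr_ge0.
rewrite (_ : _ - _ = (x - clip x) * (x + clip x - u *+ 2)); last by ring.
rewrite /clip; case: (leP 1 x) => x1; first by rewrite max_r // mulr_ge0 //; lra.
case: (leP 0 x) => x0; first by rewrite subrr mul0r.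
by rewrite mulr_le0 //; lra.
Qed.

(** Clipping does not increase the potential [(x t - u) ^+ 2], so a step lowers it by at least
    [2 * (u - x t) * phi t / n - 1 / n ^+ 2]. Telescoped over [n ^ 2] steps, the initial potential
    and the quadratic terms contribute at most 1 each. *)
Lemma online_regret (n : nat) (phi x : nat -> R) u : (0 < n)%N ->
  x 0%N = 0 -> (forall t, x t.+1 = clip (x t + phi t / n%:R)) ->
  (forall t, `|phi t| <= 1) -> 0 <= u <= 1 ->
  \sum_(t < n ^ 2) (u - x t) * phi t <= n%:R.
Proof.
move=> n0 x0 xS phi1 u01; have n0R : 0 < n%:R :> R by rewrite ltr0n.
have regret T : 2 * (\sum_(t < T) (u - x t) * phi t) / n%:R <=
    u ^+ 2 + T%:R / n%:R ^+ 2 - (x T - u) ^+ 2.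
  elim: T => [|T IH]; first by rewrite big_ord0 x0; lra.
  rewrite big_ord_recr /= xS.
  have := clip_nonexpansive (x T + phi T / n%:R) u01.
  have : (phi T / n%:R) ^+ 2 <= 1 / n%:R ^+ 2.
    rewrite exprMn exprVn ler_wpM2r ?invr_ge0 ?sqr_ge0 //.
    by rewrite -real_normK ?num_real // expr_le1.
  rewrite -natr1 !mulrDl mulrDr mulrDl; nra.
have := regret (n ^ 2)%N; rewrite natrX divff ?expf_neq0 ?gt_eqF //.
have /andP[u0 u1] := u01; rewrite ler_pdivrMr // => h.
have le2 : u ^+ 2 + 1 - (x (n ^ 2)%N - u) ^+ 2 <= 2.
  have := sqr_ge0 (x (n ^ 2)%N - u); have := expr_le1 (ltn0Sn 1) u0; rewrite u1; lra.
have := le_trans h (ler_wpM2r (ltW n0R) le2); lra.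
Qed.

End ScalarLemmas.

(** * Test classes and structured functions *)

Section TestClass.
Variables (R : realType) (G : finType) (t0 : G).
Implicit Types (h phi psi : G -> R) (e C : R).
Variable D : (G -> R) -> Prop.

Definition small h e := forall phi, D phi -> `|average (fun y => h y * phi y)| <= e.

(* By duality, phi is structured with constant C when it behaves like a
   combination of tests of total weight at most C. *)
Definition structured C phi :=
  forall h e, small h e -> `|average (fun y => h y * phi y)| <= C * e.

(** Products of tests are only required to be structured: for the dual functions below, a product
    acts as an average of tests and need not be a test itself. *)
Record test_class : Prop := TestClass {
  test_bounded : forall phi, D phi -> forall y, `|phi y| <= 1;
  test_one : D (fun _ => 1);
  test_mul : forall phi psi, D phi -> D psi -> structured 1 (fun y => phi y * psi y)
}.

Hypothesis DP : test_class.

Lemma structured_test phi : D phi -> structured 1 phi.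
Proof. by move=> Dphi h e /(_ _ Dphi); rewrite mul1r. Qed.

Lemma structured_ext C phi psi : phi =1 psi -> structured C phi -> structured C psi.
Proof.
move=> E sphi h e /sphi; rewrite (eq_average (H := fun y => h y * psi y)) // => y.
by rewrite E.
Qed.

Lemma structuredD C C' phi psi : structured C phi -> structured C' psi ->
  structured (C + C') (fun y => phi y + psi y).
Proof.
move=> sphi spsi h e he; under eq_average => y do rewrite mulrDr.
rewrite averageD mulrDl; apply: le_trans (ler_normD _ _) _.
by apply: lerD; [exact: sphi|exact: spsi].
Qed.

Lemma structuredZ C phi a : structured C phi ->
  structured (`|a| * C) (fun y => a * phi y).
Proof.
move=> sphi h e he; under eq_average => y do rewrite mulrCA.
by rewrite averageZ normrM -mulrA ler_wpM2l // sphi.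
Qed.

(** The factors are absorbed into [h] in turn, until only a product of two tests remains. *)
Lemma structuredM C C' phi psi : structured C phi -> structured C' psi ->
  structured (C * C') (fun y => phi y * psi y).
Proof.
move=> sphi spsi h e he.
rewrite (eq_average (H := fun y => (h y * psi y) * phi y)); last by move=> y; ring.
rewrite -mulrA; apply: sphi => chi Dchi.
rewrite (eq_average (H := fun y => (h y * chi y) * psi y)); last by move=> y; ring.
apply: spsi => xi Dxi.
rewrite (eq_average (H := fun y => h y * (chi y * xi y))); last by move=> y; ring.
by rewrite -[e]mul1r; apply: (test_mul DP).
Qed.

Lemma structured0 : structured 0 (fun _ => 0).
Proof.
move=> h e _; rewrite (eq_average (H := fun _ => 0)); last by move=> y; rewrite mulr0.
by rewrite average_cst // normr0 mul0r.
Qed.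

Lemma structured_sum (T : nat) (F : nat -> G -> R) :
  (forall t, structured 1 (F t)) ->
  structured T%:R (fun y => \sum_(t < T) F t y).
Proof.
move=> sF; elim: T => [|T IH].
  by apply: structured_ext structured0 => y; rewrite big_ord0.
rewrite -natr1; apply: structured_ext (structuredD IH (sF T)) => y.
by rewrite big_ord_recr.
Qed.

Fixpoint newton_weight n : R :=
  if n is n'.+1 then newton_weight n' + 2^-1 * (1 + newton_weight n' ^+ 2) else 0.

Lemma structured_newton n psi : structured 1 psi ->
  structured (newton_weight n) (fun y => newton_abs n (psi y)).
Proof.
move=> spsi; elim: n => [|n IH] /=; first exact: structured0.
have := structuredD (structuredM spsi spsi) (structuredZ (-1) (structuredM IH IH)).
rewrite normrN1 !mul1r => /(structuredZ 2^-1).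
rewrite ger0_norm ?invr_ge0 // => s2.
by apply: structured_ext (structuredD IH s2) => y; ring.
Qed.

End TestClass.

(** The positive part is half of [psi + |psi|]. Both [psi] and the polynomial [q] close to [|psi|]
    are structured, hence nearly orthogonal to [nu - 1]; the approximation error is weighed by
    [nu + 1], whose average is at most 3. *)
Lemma positive_part_pseudorandom (R : realType) (kappa : R) : 0 < kappa ->
  exists2 eps : R, 0 < eps &
  forall (G : finType) (D : (G -> R) -> Prop) (nu psi : G -> R), G ->
  test_class D -> (forall y, 0 <= nu y) -> small D (fun y => nu y - 1) eps ->
  structured D 1 psi -> (forall y, `|psi y| <= 1) ->
  `|average (fun y => (nu y - 1) * Num.max (psi y) 0)| <= kappa.
Proof.
move=> kappa0.
pose n := Num.truncn (6 / kappa); pose C := newton_weight R n.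
have nk : 2 / n.+2%:R <= kappa / 3.
  rewrite ler_pdivrMr ?ltr0n // mulrAC ler_pdivlMr // -ler_pdivrMl //.
  apply: le_trans (_ : _ <= n.+1%:R) _; last by rewrite ler_nat.
  by rewrite ltW // mulrC (_ : 2 * 3 = 6) ?truncnS_gt // -natrM.
have C0 : 0 <= C.
  rewrite /C; elim: n {nk C} => //= n C0.
  by rewrite addr_ge0 // mulr_ge0 ?addr_ge0 ?sqr_ge0.
exists (Num.min 1 (kappa / (1 + C))); first by rewrite lt_min ltr01 divr_gt0 // ltr_wpDr.
set eps := Num.min _ _ => G D nu psi t0 DP nu0 nuD spsi psi1.
have eps1 : eps <= 1 by rewrite ge_min lexx.
have epsC : (1 + C) * eps <= kappa.
  by rewrite mulrC -ler_pdivlMr ?ltr_wpDr // ge_min lexx orbT.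
pose q y := newton_abs n (psi y).
have Enu : average nu <= 2.
  have := nuD _ (test_one DP); under eq_average => y do rewrite mulr1.
  by rewrite averageB average_cst // ler_norml => /andP[_]; lra.
have Eq := structured_newton t0 DP n spsi nuD.
have Epsi := spsi _ _ nuD; rewrite mul1r in Epsi.
have Eabs : `|average (fun y => (nu y - 1) * (`|psi y| - q y))| <= kappa.
  apply: le_trans (ler_norm_average _) _.
  apply: le_trans (_ : _ <= average (fun y => kappa / 3 * (nu y + 1))) _.
    apply: ler_average => y; rewrite normrM mulrC.
    have [/andP[_ qp] qk] := newton_absP n (psi1 y).
    apply: ler_pM => //; first by rewrite ger0_norm ?subr_ge0 // (le_trans qk).
    by apply: le_trans (ler_normB _ _) _; rewrite normr1 ger0_norm.
  rewrite averageZ averageD average_cst //.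
  by have := divr_gt0 kappa0 (ltr0n R 3); nra.
have -> : average (fun y => (nu y - 1) * Num.max (psi y) 0) =
    2^-1 * (average (fun y => (nu y - 1) * psi y) +
      average (fun y => (nu y - 1) * q y) +
      average (fun y => (nu y - 1) * (`|psi y| - q y))).
  rewrite -!averageD -averageZ; apply: eq_average => y.
  case: (leP 0 (psi y)) => p0; first by rewrite ger0_norm //; field.
  by rewrite ltr0_norm //; field.
move: Eq Epsi Eabs; rewrite -/q -/C !ler_norml => /andP[? ?] /andP[? ?] /andP[? ?].
by apply/andP; split; lra.
Qed.

(** Otherwise each candidate [g] has a signed test correlating with [f - g] by at least [eta], and
    the ascent can run for [T = n ^ 2] steps. The correlations sum to at least [T * eta], whereas
    the regret bound and the pseudorandomness of [nu] allow at most [T * (eta / 2) + n], too little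
    for [n > 2 / eta]. *)
Lemma dense_model (R : realType) (eta : R) : 0 < eta ->
  exists2 eps : R, 0 < eps &
  forall (G : finType) (D : (G -> R) -> Prop) (nu f : G -> R), G ->
  test_class D -> small D (fun y => nu y - 1) eps ->
  (forall y, 0 <= f y <= nu y) ->
  exists2 g : G -> R, (forall y, 0 <= g y <= 1) & small D (fun y => f y - g y) eta.
Proof.
move=> eta0.
have [eps eps0 pseudo] := positive_part_pseudorandom (divr_gt0 eta0 (ltr0n R 2)).
exists eps => // G D nu f t0 DP nuD f_nu; apply: contrapT => no_model.
have nu0 y : 0 <= nu y by have /andP[] := f_nu y; apply: le_trans.
(* [pick g] is a test up to sign, so it is recorded as structured; for [g] outside [0, 1] the choice
   is arbitrary. *)
have /choice[pick pickP] (g : G -> R) : exists phi : G -> R,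
    (forall y, 0 <= g y <= 1) ->
    [/\ structured D 1 phi, forall y, `|phi y| <= 1 &
        eta <= average (fun y => (f y - g y) * phi y)].
  have [g01|] := pselect (forall y, 0 <= g y <= 1); last by exists (fun _ => 0).
  have /existsNP[phi /not_implyP[Dphi /negP]] : ~ small D (fun y => f y - g y) eta.
    by move=> fg; apply: no_model; exists g.
  rewrite -ltNge ltr_normr => /orP[lt_eta|lt_eta].
    exists phi => _; split; [exact: structured_test|exact: (test_bounded DP)|exact: ltW].
  exists (fun y => -1 * phi y) => _; split.
  - by have := structuredZ (-1) (structured_test Dphi); rewrite normrN1 mul1r.
  - by move=> y; rewrite mulN1r normrN; apply: (test_bounded DP).
  - rewrite (eq_average (H := fun y => - ((f y - g y) * phi y))).
      by rewrite averageN ltW.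
    by move=> y; ring.
pose n := (Num.truncn (2 / eta)).+1.
have n0 : 0 < n%:R :> R by rewrite ltr0n.
have n_eta : 2 < eta * n%:R by rewrite mulrC -ltr_pdivrMr // truncnS_gt.
pose g := fix g t := if t is t'.+1 then
  fun y => clip (g t' y + pick (g t') y / n%:R) else fun _ : G => 0.
have g01 t y : 0 <= g t y <= 1.
  by case: t => [|t]; [rewrite lexx ler01|exact: clip01].
pose phi t := pick (g t).
have phiS t : structured D 1 (phi t) by have [] := pickP _ (g01 t).
have phi1 t y : `|phi t y| <= 1 by have [_ ->] := pickP _ (g01 t).
have phi_eta t : eta <= average (fun y => (f y - g t y) * phi t y).
  by have [] := pickP _ (g01 t).
pose T := (n ^ 2)%N; pose S y := \sum_(t < T) phi t y.
pose psi y := T%:R^-1 * S y.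
have T0 : 0 < T%:R :> R by rewrite ltr0n expn_gt0.
have SE y : S y = T%:R * psi y by rewrite /psi mulrA divff ?mul1r ?gt_eqF.
have psiS : structured D 1 psi.
  have := structuredZ T%:R^-1 (structured_sum t0 T phiS).
  by rewrite ger0_norm ?invr_ge0 ?ltW // mulVf ?gt_eqF.
have psi1 y : `|psi y| <= 1.
  rewrite normrM ger0_norm ?invr_ge0 ?(ltW T0) // ler_pdivrMl // mulr1.
  apply: le_trans (ler_norm_sum _ _ _) _.
  apply: le_trans (_ : _ <= \sum_(t < T) 1) _; first exact: ler_sum.
  by rewrite sumr_const card_ord.
have := pseudo G D nu psi t0 DP nu0 nuD psiS psi1.
rewrite ler_norml => /andP[_ pseudo_psi].
have sum_eta : T%:R * eta <=
    \sum_(t < T) average (fun y => (f y - g t y) * phi t y).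
  rewrite -[T in T%:R]card_ord mulr_natl -sumr_const.
  by apply: ler_sum => t _; apply: phi_eta.
have pointwise y : \sum_(t < T) (f y - g t y) * phi t y <=
    T%:R * ((nu y - 1) * Num.max (psi y) 0) + n%:R.
  (* The comparison point follows the sign of [psi], so that [(f - u) * psi] is at most [nu - 1]
     times the positive part of [psi]. *)
  pose u : R := if 0 <= psi y then 1 else 0.
  have u01 : 0 <= u <= 1 by rewrite /u; case: ifP; rewrite lexx ler01.
  have /(_ (fun t => phi t y) (fun t => g t y)) := online_regret (n := n) _ _ _ _ u01.
  move=> /(_ isT erefl (fun=> erefl) (phi1^~ y)) regret.
  have -> : \sum_(t < T) (f y - g t y) * phi t y =
      (f y - u) * S y + \sum_(t < T) (u - g t y) * phi t y.
    rewrite mulr_sumr -big_split; apply: eq_bigr => t _ /=; ring.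
  apply: lerD => //; rewrite SE mulrCA ler_pM2l //.
  have /andP[f0 fn] := f_nu y; rewrite /u; case: (lerP 0 (psi y)) => p0; nra.
have : T%:R * eta <= T%:R * (eta / 2) + n%:R.
  apply: le_trans sum_eta _; rewrite -average_sum.
  apply: le_trans (ler_average pointwise) _.
  by rewrite averageD averageZ average_cst // lerD2r ler_pM2l.
rewrite /T natrX; nra.
Qed.

(** * Linear forms and cut norms on a finite abelian group *)

Section LinearForms.
Variables (R : realType) (k : nat) (G : finZmodType).
Local Notation I := 'I_k.+2.
Local Notation X := {ffun I -> G}.
Implicit Types (x z : X) (i j l : I) (t : G) (h phi : G -> R).

(** The variable [j] gets coefficient zero, so the sum may run over all indices. *)
Definition form j x : G := \sum_i x i *~ (i%:Z - j%:Z).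

Lemma form_indep j : indep j (form j).
Proof.
move=> x t; apply: eq_bigr => i _; case: (eqVneq i j) => [->|ij].
  by rewrite subrr !mulr0z.
by rewrite upd_other.
Qed.

Lemma formD j x z : form j (x + z) = form j x + form j z.
Proof. by rewrite /form -big_split; apply: eq_bigr => i _; rewrite ffunE mulrzDl. Qed.

Definition axis i t : X := [ffun l => if l == i then t else 0].

Lemma form_axis j i t : form j (axis i t) = t *~ (i%:Z - j%:Z).
Proof.
rewrite /form (bigD1 i) //= ffunE eqxx big1 ?addr0 // => l /negbTE li.
by rewrite ffunE li mul0rz.
Qed.

Let i0 : I := ord0.
Let i1 : I := Ordinal (isT : (1 < k.+2)%N).

(** Write [form j x] as [A x + B x *+ j]. Translating [x] by [s p] translates the pair of [A x] and
    [B x] by [p], so this pair is uniformly distributed. *)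
Lemma average_ap (f : G -> R) :
  average (fun x => \prod_j f (form j x)) =
  average (fun p : G * G => \prod_(j < k.+2) f (p.1 + p.2 *+ j)).
Proof.
pose A := form i0; pose B x := - \sum_i x i.
pose s (p : G * G) : X := axis i1 p.1 + axis i0 (- (p.1 + p.2)).
pose Phi (p : G * G) := \prod_(j < k.+2) f (p.1 + p.2 *+ j).
have formE j x : form j x = A x + B x *+ j.
  rewrite /A /B mulNrn -sumrMnl -sumrB; apply: eq_bigr => i _.
  by rewrite subr0 mulrzBr.
have As p x : A (x + s p) = A x + p.1.
  by rewrite /A !formD !form_axis subrr mulr0z addr0 subr0 mulr1z.
have sum_axis i t : \sum_l axis i t l = t.
  by rewrite (bigD1 i) //= ffunE eqxx big1 ?addr0 // => l /negbTE li; rewrite ffunE li.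
have Bs p x : B (x + s p) = B x + p.2.
  rewrite /B (eq_bigr (fun i => x i + (axis i1 p.1 i + axis i0 (- (p.1 + p.2)) i))).
    by rewrite !big_split /= !sum_axis opprD [X in _ + X]opprD opprK addKr.
  by move=> i _; rewrite !ffunE.
transitivity (average (fun p : G * G =>
    average (fun x => Phi (A (x + s p), B (x + s p))))).
  rewrite -[LHS](average_cst _ ((0, 0) : G * G)); apply: eq_average => p.
  rewrite (reindex_average (h := fun x => x + s p)); last exact: addIr.
  by apply: eq_average => x /=; apply: eq_bigr => j _; rewrite formE.
rewrite exchange_average -[RHS](average_cst _ (0 : X)); apply: eq_average => x.
rewrite [RHS](reindex_average (h := fun p => (A x + p.1, B x + p.2))).
  by apply: eq_average => p; rewrite As Bs.
by move=> [a b] [a' b'] [/addrI -> /addrI ->].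
Qed.

(** An average over the fibre of [form i0] above [y]: the point [x] is moved into it along the axis
    [i1], on which [form i0] has coefficient 1. *)
Definition dual (u : I -> X -> R) (y : G) : R :=
  average (fun x => \prod_(i | i != i0) u i (x + axis i1 (y - form i0 x))).

Lemma average_dual h (u : I -> X -> R) :
  average (fun y => h y * dual u y) =
  average (fun x => h (form i0 x) * \prod_(i | i != i0) u i x).
Proof.
pose U x := \prod_(i | i != i0) u i x.
transitivity (average (fun y => average (fun x =>
    h y * U (x + axis i1 (y - form i0 x))))).
  by apply: eq_average => y; rewrite -averageZ.
rewrite exchange_average.
transitivity (average (fun x => average (fun t =>
    h (form i0 (x + axis i1 t)) * U (x + axis i1 t)))).
  apply: eq_average => x.
  rewrite (reindex_average (h := fun t => form i0 x + t)); last exact: addrI.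
  apply: eq_average => t /=.
  by rewrite [_ + t - _]addrAC subrr add0r formD form_axis subr0 mulr1z.
rewrite exchange_average -[RHS](average_cst _ (0 : G)); apply: eq_average => t.
rewrite -(reindex_average (h := fun x => x + axis i1 t)
  (fun x => h (form i0 x) * U x)) //; exact: addIr.
Qed.

Definition test phi := exists2 u : I -> X -> R,
  (forall i, indep i (u i)) /\ (forall i x, `|u i x| <= 1) & phi =1 dual u.

Lemma norm_average_le1 (T : finType) (F : T -> R) : T ->
  (forall y, `|F y| <= 1) -> `|average F| <= 1.
Proof.
move=> y0 F1; apply: le_trans (ler_norm_average _) _.
by rewrite -[leRHS](average_cst 1 y0); apply: ler_average.
Qed.

Lemma norm_prod_le1 (P : pred I) (F : I -> R) : (forall i, `|F i| <= 1) ->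
  `|\prod_(i | P i) F i| <= 1.
Proof.
move=> F1; rewrite normr_prod.
by have /andP[] := @prod_in01 R _ (index_enum I) P (fun i => `|F i|)
  (fun i _ => introT andP (conj (normr_ge0 _) (F1 i))).
Qed.

Lemma testP : test_class test.
Proof.
split=> [phi [u [_ u1] phiE] y||phi psi [u [uI u1] phiE] [v [vI v1] psiE] h e he].
- rewrite phiE; apply: norm_average_le1 => [|x]; first exact: 0.
  by apply: norm_prod_le1.
- exists (fun _ _ => 1); first by split=> // i x; rewrite normr1.
  move=> y; rewrite -[LHS](average_cst 1 (0 : X)); apply: eq_average => x.
  by rewrite big1.
rewrite mul1r (eq_average (H := fun y => (h y * psi y) * dual u y)); last first.
  by move=> y; rewrite phiE; ring.
rewrite average_dual.
(* [x + w z] runs over the fibre of [form i0] through [x]. For fixed [z], the product of [u i x] and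
   [v i (x + w z)] still ignores the coordinate [i]. *)
pose w z := z - axis i1 (form i0 z).
have -> : average (fun x => h (form i0 x) * psi (form i0 x) * \prod_(i | i != i0) u i x)
    = average (fun z => average (fun x => h (form i0 x) *
        \prod_(i | i != i0) (u i x * v i (x + w z)))).
  rewrite exchange_average; apply: eq_average => x.
  rewrite averageZ -mulrA; congr (_ * _); rewrite psiE mulrC.
  rewrite /dual (reindex_average (h := fun z => x + z)); last exact: addrI.
  rewrite -averageZ; apply: eq_average => z /=; rewrite -big_split; apply: eq_bigr => i _.
  congr (_ * v i _); rewrite formD /w -addrA; congr (x + (z + _)).
  by apply/ffunP => l; rewrite !ffunE; case: eqP => _; rewrite ?oppr0 // opprD addNKr.
rewrite -(average_cst e (0 : X)); apply: le_trans (ler_norm_average _) _.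
apply: ler_average => z; rewrite -average_dual; apply: he.
eexists; last by move=> y; reflexivity.
split=> [i|i x]; last by rewrite normrM mulr_ile1.
apply: indepM => // x t; rewrite -(vI i (x + w z) (t + w z i)); congr (v i _).
by apply/ffunP => l; rewrite !ffunE; case: eqP => [->|].
Qed.

Hypothesis mulrnI : forall a, (0 < a < k.+2)%N -> injective (fun t : G => t *+ a).

Lemma mulrz_form_inj i j : i != j -> injective (fun t : G => t *~ (i%:Z - j%:Z)).
Proof.
have main (a b : I) : (a < b)%N -> injective (fun t : G => t *~ (b%:Z - a%:Z)).
  move=> ab s t; rewrite subzn ?(ltnW ab) //; apply: (mulrnI (a := b - a)).
  by rewrite subn_gt0 ab (leq_ltn_trans (leq_subr _ _)).
move=> ij; case: (ltngtP i j) => [|/main //|/val_inj /eqP]; last by rewrite (negbTE ij).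
move=> /main ji s t; rewrite -opprB !mulrNz => /oppr_inj; exact: ji.
Qed.

(* Permuting the variables and rescaling them turns form j into form i0. *)
Lemma small_cut j h e : small test h e -> cut_le j (fun x => h (form j x)) e.
Proof.
move=> he u uI u1; pose s := tperm i0 j.
have sj i : (s i != i0) = (i != j).
  by rewrite -(inj_eq (@perm_inj _ s)) tpermK tpermL.
(* [inv i] rescales the variable so that its coefficient in [form j] becomes that of [s i] in
   [form i0]. For [i = j] both coefficients vanish and the identity will do. *)
have /choice[inv invP] (i : I) : exists c : G -> G, injective c /\
    (i != j -> forall t, c t *~ (i%:Z - j%:Z) = t *~ ((s i)%:Z - i0%:Z)).
  case: (eqVneq i j) => [_|ij]; first by exists id; split=> // a b.
  have iI := mulrz_form_inj ij; have sI : s i != i0 by rewrite sj.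
  exists (fun t => invF iI (t *~ ((s i)%:Z - i0%:Z))); split.
    by move=> a b /(can_inj (f_invF iI)); apply: mulrz_form_inj.
  by move=> _ t; apply: (f_invF iI).
pose T (y : X) : X := [ffun i => inv i (y (s i))].
have TI : injective T.
  move=> y y' /ffunP yy; apply/ffunP => i; have := yy (s i); rewrite !ffunE tpermK.
  by apply: (invP _).1.
have formT y : form j (T y) = form i0 y.
  rewrite /form (bigD1 j) //= subrr mulr0z add0r.
  rewrite [RHS](bigD1 i0) //= subrr mulr0z add0r [RHS](reindex_inj (@perm_inj _ s)).
  by apply: eq_big => i; rewrite ?sj // => ij; rewrite ffunE (invP _).2.
rewrite (reindex_average (h := T)) //.
have -> : average ((fun x => h (form j x) * \prod_(i | i != j) u i x) \o T) =
    average (fun y => h (form i0 y) * \prod_(i | i != i0) u (s i) (T y)).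
  apply: eq_average => y /=; rewrite formT; congr (_ * _).
  rewrite [RHS](reindex_inj (@perm_inj _ s)).
  by apply: eq_big => i; rewrite ?sj // => ij; rewrite tpermK.
rewrite -average_dual; apply: he; eexists; last by move=> y; reflexivity.
split=> // i y t; rewrite -(uI (s i) (T y) (inv (s i) t)); congr (u _ _).
apply/ffunP => l; rewrite !ffunE (canF_eq (tpermK i0 j)).
by case: eqP => // ->.
Qed.

End LinearForms.

(** * Transference *)

(** The average of a dense model may fall slightly short of [delta]. Moving [g] towards the constant
    1 by the proportion [t] raises it to exactly [delta], and [delta <= 1] gives [t <= 1]. *)
Lemma raise_average (R : realType) (G : finType) (g : G -> R) (delta e : R) : G ->
  (forall y, 0 <= g y <= 1) -> delta <= 1 -> 0 <= e -> delta <= average g + e ->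
  exists g' : G -> R, [/\ forall y, 0 <= g' y <= 1, delta <= average g' &
    average (fun y => `|g' y - g y|) <= e].
Proof.
move=> t0 g01 delta1 e0 h; have [le_d|lt_d] := leP delta (average g).
  exists g; split=> //; rewrite (eq_average (H := fun _ => 0)) ?average_cst // => y.
  by rewrite subrr normr0.
have a1 : 0 < 1 - average g by rewrite subr_gt0; apply: lt_le_trans lt_d delta1.
pose t := (delta - average g) / (1 - average g).
have t0' : 0 <= t by rewrite divr_ge0 ?(ltW a1) // subr_ge0 ltW.
have t1 : t <= 1 by rewrite ler_pdivrMr // mul1r lerD2r.
have tE : t * (1 - average g) = delta - average g by rewrite /t divfK ?gt_eqF.
exists (fun y => g y + t * (1 - g y)); split=> [y||].
- by have /andP[g0 g1] := g01 y; apply/andP; split; nra.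
- by rewrite averageD averageZ averageB average_cst // tE; lra.
rewrite (eq_average (H := fun y => t * (1 - g y))) => [|y].
  by rewrite averageZ averageB average_cst // tE; lra.
by have /andP[g0 g1] := g01 y; rewrite addrC addKr ger0_norm // mulr_ge0 ?subr_ge0.
Qed.

(** The cut norm error [eps1] is shared equally between the dense model and the raising of its
    average; the counting lemma for the linear forms then compares the progressions. *)
Lemma transference (R : realType) (k : nat) (eta : R) : 0 < eta ->
  exists2 eps : R, 0 < eps &
  forall (G : finZmodType) (nu f : G -> R) (delta : R),
  (forall a, (0 < a < k.+2)%N -> injective (fun t : G => t *+ a)) ->
  forms_condition (fun (j : 'I_k.+2) x => nu (form j x)) eps ->
  (forall y, 0 <= f y <= nu y) -> delta <= 1 -> delta <= average f ->
  exists g : G -> R, [/\ forall y, 0 <= g y <= 1, delta <= average g &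
    `|average (fun p : G * G => \prod_(i < k.+2) f (p.1 + p.2 *+ i)) -
      average (fun p : G * G => \prod_(i < k.+2) g (p.1 + p.2 *+ i))| <= eta].
Proof.
move=> eta0.
have [eps1 eps1_gt0 counting] := relative_counting 'I_k.+2 k.+2 eta0.
have [eps2 eps2_gt0 model] := dense_model (divr_gt0 eps1_gt0 (ltr0n R 2)).
have [eps3 eps3_gt0 pseudo] := weight_pseudorandom 'I_k.+2 eps2_gt0.
exists (Num.min eps1 eps3); first by rewrite lt_min eps1_gt0.
move=> G nu f delta mulI lf f_nu delta1 delta_f.
have nu0 y : 0 <= nu y by have /andP[] := f_nu y; apply: le_trans.
pose nus (j : 'I_k.+2) (x : {ffun 'I_k.+2 -> G}) := nu (form j x).
have comp_indep (h : G -> R) (j : 'I_k.+2) :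
    indep j (fun x : {ffun 'I_k.+2 -> G} => h (form j x)).
  by move=> x t; rewrite form_indep.
have nuW : weights nus by move=> j; split; [exact: comp_indep|move=> x; exact: nu0].
(* Against a dual function, this is [weight_pseudorandom] with all [u i] bounded by 1 and a constant
   second family. *)
have nu_small : small (@test R k G) (fun y => nu y - 1) eps2.
  move=> phi [u [uI u1] phiE].
  rewrite (eq_average (H := fun y => (nu y - 1) * dual u y)); last first.
    by move=> y; rewrite phiE.
  rewrite average_dual.
  have lf3 : forms_condition nus eps3 by apply: ler_forms lf; rewrite ge_min lexx orbT.
  have M1 i x : majorant nus finset.set0 i x = 1 by rewrite /majorant inE.
  have le1 (v : 'I_k.+2 -> {ffun 'I_k.+2 -> G} -> R) : (forall i x, `|v i x| <= 1) ->
      forall i x, `|v i x| <= majorant nus finset.set0 i x.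
    by move=> v1 i x; rewrite M1.
  have norm1 (i : 'I_k.+2) (x : {ffun 'I_k.+2 -> G}) : `|1 : R| <= 1 by rewrite normr1.
  have := pseudo G nus 0 nuW lf3 ord0 finset.set0 finset.set0 u (fun _ _ => 1) uI
    (fun _ _ _ => erefl) (le1 _ u1) (le1 _ norm1).
  have -> : average (fun x => (nus ord0 x - 1) * densify ord0 u x *
        densify ord0 (fun _ _ => 1) x) =
      average (fun x => (nus ord0 x - 1) * densify ord0 u x).
    by apply: eq_average => x; rewrite (densify1 _ (0 : G)) mulr1.
  rewrite (@average_densify _ _ _ (0 : G) ord0 (fun x => nus ord0 x - 1)) //.
  by move=> x t; rewrite (nuW _).1.
have [g g01 fg] := model G _ nu f 0 (testP R k G) nu_small f_nu.
have fg_average : average f - average g <= eps1 / 2.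
  have := fg _ (test_one (testP R k G)); under eq_average => y do rewrite mulr1.
  by rewrite averageB ler_norml => /andP[].
have eps1_ge0 : 0 <= eps1 / 2 by rewrite divr_ge0 // ltW.
have delta_g : delta <= average g + eps1 / 2 by lra.
have [g' [g'01 delta_g' g'g]] := raise_average (0 : G) g01 delta1 eps1_ge0 delta_g.
exists g'; split=> //; rewrite -!average_ap.
have lf1 : forms_condition nus eps1 by apply: ler_forms lf; rewrite ge_min lexx.
apply: (counting G nus 0 nuW lf1 [set: 'I_k.+2]%SET
  (fun j x => f (form j x)) (fun j x => g' (form j x))) => //.
- by rewrite cardsT card_ord.
- by move=> i x; rewrite /majorant inE.
- move=> i; apply: (@small_cut _ _ _ mulI i (fun y => f y - g' y)) => phi Dphi.
  rewrite (eq_average (H := fun y => (f y - g y) * phi y - (g' y - g y) * phi y));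
    last by move=> y; ring.
  rewrite averageB [leRHS]splitr; apply: le_trans (ler_normB _ _) _.
  apply: lerD; first exact: fg.
  apply: le_trans g'g; apply: le_trans (ler_norm_average _) _.
  apply: ler_average => y; rewrite normrM ler_piMr //.
  exact: test_bounded (testP R k G) _ Dphi y.
Qed.

(** * From exponents to sets of factors *)

Section Conversion.
Variables (R : realType) (k N : nat) (nu : Zmod N -> R).
Local Notation I := 'I_k.+2.

(** The default value [false] at [j] identifies the vertices over [others j] with the sets that
    avoid [j]. *)
Definition extend (j : I) (w : {ffun others j -> bool}) : {set I} :=
  [set i | oapp w false (insub i)].

Definition restrict (j : I) (W : {set I}) : {ffun others j -> bool} :=
  [ffun i => val i \in W].

Lemma extendK j : cancel (@extend j) (restrict j).
Proof. by move=> w; apply/ffunP => i; rewrite !ffunE inE valK. Qed.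

Lemma restrictK j (W : {set I}) : j \notin W -> extend (restrict j W) = W.
Proof.
move=> jW; apply/setP => i; rewrite inE; case: insubP => [s _ <-|] /=.
  by rewrite ffunE.
by rewrite negbK => /eqP ->; rewrite (negbTE jW).
Qed.

Lemma extend_self j (w : {ffun others j -> bool}) : j \notin extend w.
Proof. by rewrite inE insubN // eqxx. Qed.

Lemma form_extend j (w : {ffun others j -> bool}) (y : {ffun I * bool -> Zmod N}) :
  \sum_(i : others j) y (val i, w i) *~ ((val i)%:Z - j%:Z) =
  form j (proj (extend w) y).
Proof.
rewrite /form [RHS](bigD1 j) //= subrr mulr0z add0r.
rewrite [RHS](reindex_omap (val : others j -> I) insub) /=; last first.
  by move=> i ij; case: insubP => [s _ <-|] //; rewrite ij.
apply: eq_big => [s|s _]; first by rewrite valK eqxx (valP s).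
by rewrite ffunE inE valK.
Qed.

Lemma linear_forms_forms_condition (eps : R) :
  (forall n : exponents k.+2, `|linear_forms_average nu n - 1| <= eps) ->
  forms_condition (fun (j : I) x => nu (form j x)) eps.
Proof.
move=> lf m mP; pose n : exponents k.+2 := fun j w => (j, extend w) \in m.
rewrite (_ : average _ = linear_forms_average nu n) //; apply: eq_average => y.
pose F (j : I) (W : {set I}) := if (j, W) \in m then nu (form j (proj W y)) else 1.
transitivity (\prod_(p : I * {set I}) F p.1 p.2).
  by rewrite /monomial big_mkcond; apply: eq_bigr => -[].
rewrite -(pair_bigA _ F) /F.
apply: eq_bigr => j _; rewrite (bigID (fun W : {set I} => j \notin W)) /=.
rewrite [X in _ * X]big1 ?mulr1 => [|W]; last first.
  by rewrite negbK => jW; case: ifP => // /mP; rewrite /= jW.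
rewrite (reindex_onto (@extend j) (restrict j)) /=; last exact: restrictK.
apply: eq_big => [w|w _]; first by rewrite extend_self extendK eqxx.
by rewrite form_extend /n; case: (_ \in m); rewrite ?expr1 ?expr0.
Qed.

End Conversion.

Lemma ord_mulrnI (n a : nat) : coprime n.+1 a -> injective (fun t : 'I_n.+1 => t *+ a).
Proof.
move=> cop s t /= /eqP; rewrite -subr_eq0 -mulrnBl => /eqP sta.
apply/eqP; rewrite -subr_eq0; move: (s - t) sta => x; rewrite Zp_mulrn.
move=> /(congr1 val) /= /eqP; rewrite -/(dvdn _ _) Gauss_dvdl // => nx.
rewrite -val_eqE /=; move: (ltn_ord x) nx.
case: (val x) => // v vn /(dvdn_leq (ltn0Sn v)).
by rewrite leqNgt vn.
Qed.

Theorem theorem2p4 (R : realType) (k : nat) (delta c : R) :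
  (3 <= k)%N -> 0 < delta -> delta <= 1 ->
  0 < c -> weighted_szemeredi k delta c ->
  forall (eps : nat -> R) (eta : R), 0 < eta ->
  exists N1 : nat,
  forall (NN : set nat) (nu : forall N : nat, Zmod N -> R),
    infinite_set NN ->
    (forall N : nat, NN N -> (0 < N)%N /\ coprime N (k.-1)`!) ->
    (forall N : nat, NN N -> forall x : Zmod N, 0 <= nu N x) ->
    linear_forms_condition k NN nu eps ->
  forall N : nat, NN N -> (N1 <= N)%N ->
  forall f : Zmod N -> R,
    (forall x : Zmod N, 0 <= f x <= nu N x) -> delta <= average f ->
  c - eta <= ap_average k f.
Proof.
case: k => [|[|k]] // _ _ delta1 _ szemeredi eps eta eta0.
have eta2 : 0 < eta / 2 by rewrite divr_gt0.
have [N0 szN0] := szemeredi _ eta2.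
have [e e0 transfer] := transference k eta2.
(* [N1] is fixed before the family [nu]. If [eps] does not tend to 0, no family satisfies the
   condition with this rate and any [N1] will do. *)
have [eps0|not_eps0] := pselect (eps @ \oo --> (0 : R)); last first.
  by exists 0%N => NN nu _ _ _ [].
have /cvgr0_norm_lt /(_ e e0)[N1 _ epsN1] := eps0.
exists (maxn N0 N1) => NN nu _ NNP _ [_ lf] N NNN.
rewrite geq_max => /andP[leN0 leN1] f f_nu delta_f.
have [Npos copN] := NNP N NNN.
have lfN : forms_condition (fun (j : 'I_k.+2) x => nu N (form j x)) e.
  apply: linear_forms_forms_condition => n; apply: le_trans (lf N NNN n) _.
  exact: le_trans (ler_norm _) (ltW (epsN1 N leN1)).
(* Each such [a] divides the factorial that is coprime to [N]. *)
have mulI a : (0 < a < k.+2)%N -> injective (fun t : Zmod N => t *+ a).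
  move=> /andP[a0 ak]; apply: ord_mulrnI; rewrite prednK //.
  by apply: coprime_dvdr copN; rewrite dvdn_fact // a0.
have [g [g01 delta_g]] := transfer _ (nu N) f delta mulI lfN f_nu delta1 delta_f.
have := szN0 N Npos leN0 g g01 delta_g.
rewrite ler_norml /ap_average => sz /andP[tr _]; lra.
Qed.
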